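(* Let $G=\mathrm{SL}(2,\mathbb{R})$, $\Gamma=\mathrm{SL}(2,\mathbb{Z})$, let $H\subseteq\Gamma$ be a subgroup of finite index, and let $\pi:G/H\to G/\Gamma$ be the natural projection. The set $$\Omega'':=\pi^{-1}(\Omega')=P\Gamma H/H=\{p_{a,b}gH:p_{a,b}\in P,\ g\in\Gamma\}$$ is a Poincaré section for the action of $N$ on $G/H$ by left multiplication, with first return time function $R\circ\pi:\Omega''\to\mathbb{R}$ and first return map $r':\Omega''\to\Omega''$ such that, for all $p_{a,b}\in P$ and $\gamma\in\Gamma$, $$r'(p_{a,b}\gamma H)=h_{R(\pi(p_{a,b}\gamma H))}\,p_{a,b}\gamma H=\begin{pmatrix}b&\lfloor\frac{1+a}{b}\rfloor b-a\\0&b^{-1}\end{pmatrix}\begin{pmatrix}\lfloor\frac{1+a}{b}\rfloor&1\\-1&0\end{pmatrix}\gamma H.$$ Identify $\Omega''$ with $P\times\Gamma/H$ via $p_{a,b}\gamma H\leftrightarrow(p_{a,b},\gamma H)$, and let $\mu_{\Omega''}$ be the measure on $\Omega''$ corresponding in this way to the product measure on $P\times\Gamma/H$ of $2\,da\,db$ with the counting measure on $\Gamma/H$. Then identify $G/H$ (up to a null set) with $\{(x,s)\in\Omega''\times\mathbb{R}:0\leq s<(R\circ\pi)(x)\}$ via $(x,s)\leftrightarrow h_sx$. Under this identification, the Haar measure $\mu_{G/H}$ on $G/H$, normalized so that $\mu_{G/H}(G/H)=\frac{\pi^2}{3}[\Gamma:H]$, is given by $d\mu_{G/H}=d\mu_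{\Omega''}\,ds$.
   Context: $\Omega=\{(a,b)\in\mathbb{R}^2:0<a,b\leq1,\ a+b>1\}$ is the Farey triangle. For $(a,b)\in\Omega$ put $p_{a,b}=\begin{pmatrix}a&b\\0&a^{-1}\end{pmatrix}$; $P=\{p_{a,b}:(a,b)\in\Omega\}$, and $\Omega'=P\Gamma/\Gamma=\{p_{a,b}\Gamma:(a,b)\in\Omega\}\subseteq G/\Gamma$, where the map $(a,b)\mapsto p_{a,b}\Gamma$ is injective on $\Omega$. The function $R:\Omega'\to\mathbb{R}$ is $R(p_{a,b}\Gamma)=\frac{1}{ab}$. For $s\in\mathbb{R}$, $h_s=\begin{pmatrix}1&0\\-s&1\end{pmatrix}$, and $N=\{h_s:s\in\mathbb{R}\}$ acts on $G/H$ by left multiplication (the horocycle flow). A subset $S\subseteq G/H$ is a Poincaré section for the action of $N$ if for almost every $\Lambda\in G/H$ (with respect to Haar measure) the set $\{s\in\mathbb{R}:h_s\Lambda\in S\}$ is nonempty, countable and discrete. Its first return time function is $x\mapsto\min\{s>0:h_sx\in S\}$ for $x\in S$, and its first return map sends $x$ to $h_tx$, where $t$ is the first return time of $x$. Haar measure on $G/H$ means the (unique up to scaling) $G$-invariant Radon measure. *)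

(* Defs.v *)
From HB Require Import structures.
From mathcomp Require Import all_boot all_order all_algebra generic_quotient.
From mathcomp Require Import all_classical all_reals all_analysis.
From mathcomp Require Import finmap zify lra.
Set Implicit Arguments.
Unset Strict Implicit.
Unset Printing Implicit Defensive.
Import Order.TTheory GRing.Theory Num.Theory.
Import numFieldNormedType.Exports.
Local Open Scope classical_set_scope.
Local Open Scope ring_scope.
Local Open Scope quotient_scope.

Record SL2 (R : realType) := MkSL2 { SL2val : 'M[R]_2; _ : \det SL2val == 1 }.

Section SL2_structures.
Variable R : realType.

HB.instance Definition _ := [isSub for @SL2val R].
HB.instance Definition _ := [Choice of SL2 R by <:].

Implicit Types g k : SL2 R.

Lemma det_SL2 g : \det (val g) = 1.
Proof. exact/eqP/(valP g). Qed.

Lemma unitmx_SL2 g : val g \in unitmx.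
Proof. by rewrite unitmxE det_SL2 unitr1. Qed.

Fact SL2_det_one : \det (1%:M : 'M[R]_2) == 1.
Proof. by rewrite det1. Qed.

Fact SL2_det_mul g k : \det (val g *m val k) == 1.
Proof. by rewrite det_mulmx !det_SL2 mulr1. Qed.

Fact SL2_det_inv g : \det (invmx (val g)) == 1.
Proof. by rewrite det_inv det_SL2 invr1. Qed.

Definition SL2_one := MkSL2 SL2_det_one.
Definition SL2_mul g k := MkSL2 (SL2_det_mul g k).
Definition SL2_inv g := MkSL2 (SL2_det_inv g).

Fact SL2_mulA : associative SL2_mul.
Proof. by move=> x y z; apply: val_inj; rewrite /= mulmxA. Qed.

Fact SL2_mul1 : left_id SL2_one SL2_mul.
Proof. by move=> x; apply: val_inj; rewrite /= mul1mx. Qed.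

Fact SL2_mulr1 : right_id SL2_one SL2_mul.
Proof. by move=> x; apply: val_inj; rewrite /= mulmx1. Qed.

Fact SL2_mulV : left_inverse SL2_one SL2_inv SL2_mul.
Proof. by move=> x; apply: val_inj; rewrite /= mulVmx ?unitmx_SL2. Qed.

Fact SL2_mulrV : right_inverse SL2_one SL2_inv SL2_mul.
Proof. by move=> x; apply: val_inj; rewrite /= mulmxV ?unitmx_SL2. Qed.

HB.instance Definition _ := isGroup.Build (SL2 R)
  SL2_mulA SL2_mul1 SL2_mulr1 SL2_mulV SL2_mulrV.

(* G carries the topology induced by the inclusion in the 2 x 2 matrices. *)
HB.instance Definition _ :=
  Topological.copy (SL2 R) (initial_topology (val : SL2 R -> 'M[R]_2)).
HB.instance Definition _ := isPointed.Build (SL2 R) SL2_one.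

End SL2_structures.

Definition mx22 (R : realType) (a b c d : R) : 'M[R]_2 :=
  \matrix_(i, j) if i == 0 then (if j == 0 then a else b)
                 else (if j == 0 then c else d).

Lemma det_mx22 (R : realType) (a b c d : R) :
  \det (mx22 a b c d) = a * d - b * c.
Proof.
rewrite (expand_det_row _ 0) !big_ord_recl big_ord0 addr0 /cofactor !det_mx11.
by rewrite !mxE /= !expr0 !mul1r expr1 mulN1r mulrN.
Qed.

(* [sl2 a b c d] is the matrix (a b; c d) if a * d - b * c = 1 (see [val_sl2]);
   otherwise it is the identity. *)
Definition sl2 (R : realType) (a b c d : R) : SL2 R :=
  insubd (SL2_one R) (mx22 a b c d).

Lemma val_sl2 (R : realType) (a b c d : R) : a * d - b * c = 1 ->
  val (sl2 a b c d) = mx22 a b c d.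
Proof. by move=> abcd; rewrite insubdK// unfold_in /= det_mx22 abcd. Qed.

Definition SL2Z {R : realType} : {pred SL2 R} :=
  [pred g | val g \is a mxOver Num.int].

Section SL2Z_group.
Variable R : realType.

Fact det_int n (A : 'M[R]_n) : A \is a mxOver Num.int -> \det A \is a Num.int.
Proof.
move=> /mxOverP intA; apply: rpred_sum => s _; apply: rpredM.
  by rewrite rpredX// rpredN rpred1.
by apply: rpred_prod => i _; exact: intA.
Qed.

Fact SL2Z_mul : mulg_closed (@SL2Z R).
Proof. by move=> x y; rewrite !inE /= => intx inty; exact: mxOverM. Qed.

Fact SL2Z_one : (SL2_one R) \in SL2Z.
Proof. by rewrite inE /=; apply/mxOverP => i j; rewrite mxE rpredMn// rpred1. Qed.

Fact SL2Z_inv : invg_closed (@SL2Z R).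
Proof.
move=> x; rewrite !inE /= => intx; rewrite /invmx unitmx_SL2 det_SL2 invr1 scale1r.
apply/mxOverP => i j; rewrite mxE; apply: rpredM.
  by rewrite rpredX// rpredN rpred1.
by apply: det_int; apply/mxOverP => k l; rewrite !mxE; exact: (mxOverP intx).
Qed.

HB.instance Definition _ := isMulClosed.Build (SL2 R) SL2Z SL2Z_mul.
HB.instance Definition _ := isMul1Closed.Build (SL2 R) SL2Z SL2Z_one.
HB.instance Definition _ := isInvClosed.Build (SL2 R) SL2Z SL2Z_inv.

End SL2Z_group.

Section cosets.
Variables (R : realType) (H : groupClosed (SL2 R)).

Definition coset_rel (x y : SL2 R) : bool := (x^-1 * y)%g \in H.

Fact coset_rel_refl : reflexive coset_rel.
Proof. by move=> x; rewrite /coset_rel mulVg gpred1. Qed.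

Fact coset_rel_sym : symmetric coset_rel.
Proof.
by move=> x y; apply/idP/idP => /gpredVr; rewrite /coset_rel invgM invgK.
Qed.

Fact coset_rel_trans : transitive coset_rel.
Proof.
move=> y x z xy yz; rewrite /coset_rel.
by rewrite -[z](mulVKg y) mulgA gpredM.
Qed.

Definition coset_equiv :=
  EquivRel coset_rel coset_rel_refl coset_rel_sym coset_rel_trans.

(* The space G/H of left cosets gH, with the quotient topology and its Borel
   sigma-algebra; the coset of g is [\pi_(coset_space H) g]. *)
Definition coset_space : Type := quotient_topology {eq_quot coset_equiv}.
HB.instance Definition _ := PointedTopological.on coset_space.
HB.instance Definition _ := Quotient.on coset_space.
HB.instance Definition _ := Measurable.copy coset_space
  (g_sigma_algebraType (@open (quotient_topology {eq_quot coset_equiv}))).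

End cosets.

Lemma coset_eqP (R : realType) (H : groupClosed (SL2 R)) (g k : SL2 R) :
  reflect (\pi_(coset_space H) g = \pi_(coset_space H) k) (g^-1 * k \in H)%g.
Proof. exact: (@eqmodP _ (coset_equiv H) g k). Qed.

Section action.
Variables (R : realType) (H : groupClosed (SL2 R)).
Implicit Types g k : SL2 R.

Definition coset_act g (x : coset_space H) : coset_space H :=
  \pi_(coset_space H) (g * repr x)%g.

Lemma coset_actE g k :
  coset_act g (\pi_(coset_space H) k) = \pi_(coset_space H) (g * k)%g.
Proof.
apply/coset_eqP; rewrite invgM -mulgA mulKg; apply/coset_eqP.
by rewrite reprK.
Qed.

(* The natural projection G/H -> G/Gamma, meaningful if H is included in
   Gamma (see [coset_projE]). *)
Definition coset_proj (x : coset_space H) : coset_space (@SL2Z R) :=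
  \pi_(coset_space SL2Z) (repr x).

Lemma coset_projE g : {subset H <= SL2Z} ->
  coset_proj (\pi_(coset_space H) g) = \pi_(coset_space SL2Z) g.
Proof. by move=> HG; apply/coset_eqP; apply: HG; apply/coset_eqP; rewrite reprK. Qed.

End action.
Arguments coset_proj {R H} x.

Section farey.
Variable R : realType.
Implicit Types (ab : R * R) (a b s : R).

Definition farey_triangle : set (R * R) :=
  [set ab | [/\ 0 < ab.1 <= 1, 0 < ab.2 <= 1 & 1 < ab.1 + ab.2]].

Lemma measurable_farey_triangle : measurable farey_triangle.
Proof.
have -> : farey_triangle =
    (`]0, 1] `*` `]0, 1]) `&` ((fun ab => ab.1 + ab.2) @^-1` `]1, +oo[).
  apply/seteqP; split=> -[a b] /=; rewrite !in_itv/= andbT; first by case.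
  by move=> -[[? ?] ?].
apply: measurableI; first exact: measurableX.
rewrite -[X in measurable X]setTI.
exact: (measurable_realfun.measurable_funD measurable_fst measurable_snd).
Qed.

(* The matrix p_{a,b}; its value is meaningful only if a != 0. *)
Definition farey_mx ab : SL2 R := sl2 ab.1 ab.2 0 ab.1^-1.

Definition horo s : SL2 R := sl2 1 0 (- s) 1.

Definition farey_mxs : set (SL2 R) := farey_mx @` farey_triangle.

(* Omega' in G/Gamma. *)
Definition farey_section : set (coset_space (@SL2Z R)) :=
  \pi_(coset_space SL2Z) @` farey_mxs.

(* The function R(p_{a,b} Gamma) = 1 / (a b) on Omega' (see [roofE]), extended
   by 0 outside Omega'. *)
Definition roof (x : coset_space (@SL2Z R)) : R :=
  xget 0 [set r | exists2 ab, farey_triangle ab &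
    x = \pi_(coset_space SL2Z) (farey_mx ab) /\ r = (ab.1 * ab.2)^-1].

Lemma val_farey_mx ab : farey_triangle ab ->
  val (farey_mx ab) = mx22 ab.1 ab.2 0 ab.1^-1.
Proof.
by move=> [/andP[a0 _] _ _]; rewrite val_sl2// mulr0 subr0 divff// gt_eqF.
Qed.

Lemma farey_mx_inj ab ab' : farey_triangle ab -> farey_triangle ab' ->
  \pi_(coset_space SL2Z) (farey_mx ab) = \pi_(coset_space SL2Z) (farey_mx ab') ->
  ab = ab'.
Proof.
case: ab ab' => [a b] [a' b'] Oab Oab' /coset_eqP.
set g := (_ * _)%g => gZ.
have gE : val (farey_mx (a, b)) *m val g = val (farey_mx (a', b')).
  by rewrite -[LHS]/(val (farey_mx (a, b) * g)%g) /g mulVKg.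
have /mxOverP gint : val g \is a mxOver Num.int by [].
move: (val g) gint gE => {g gZ} M gint.
rewrite !val_farey_mx// => /matrixP gE.
have := gE 0 0; have := gE 0 1; have := gE 1 0; have := gE 1 1.
rewrite !mxE !big_ord_recl !big_ord0 !mxE /=.
have -> : lift ord0 ord0 = 1 :> 'I_2 by apply: val_inj.
have -> : ord0 = 0 :> 'I_2 by apply: val_inj.
rewrite !mul0r !add0r !addr0.
case: Oab Oab' => /= /andP[a0 a1] /andP[b0 b1] ab1.
move=> [/= /andP[a'0 a'1] /andP[b'0 b'1] ab'1].
have /intrP[m mE] := gint 0 1; have /intrP[n nE] := gint 0 0.
move=> e11 e10 e01 e00.
have g10 : M 1 0 = 0.
  by move/eqP : e10; rewrite mulf_eq0 invr_eq0 gt_eqF//= => /eqP.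
have e00' : a * n%:~R = a' by rewrite -e00 g10 mulr0 addr0 nE.
have /intrP[k kE] := gint 1 1.
have kE' : k%:~R = a / a'.
  by rewrite -e11 kE mulrA divff ?mul1r// gt_eqF.
have n0 : 0 < n%:~R :> R by rewrite -(pmulr_rgt0 _ a0) e00'.
have k0 : 0 < k%:~R :> R by rewrite kE' divr_gt0.
have nk : n * k = 1.
  apply: (@intr_inj R); rewrite intrM kE' -e00' invfM.
  by rewrite (mulrA a) divff ?gt_eqF// mul1r divff// gt_eqF.
have n1 : n = 1 by move: n0 k0 nk; rewrite !ltr0z; nia.
have aa' : a = a' by rewrite -e00' n1 mulr1.
have g11 : M 1 1 = 1.
  by rewrite kE kE' -aa' divff// gt_eqF.
have bE : b' = b + a * m%:~R by rewrite -e01 mE g11 mulr1 addrC.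
have m0 : m = 0.
  have m1 : -1 < m.
    by rewrite -(ltr_int R) -(ltr_pM2l a0) rmorphN1 mulrN1; lra.
  have m2 : m < 1 by rewrite -(ltr_int R) -(ltr_pM2l a0) mulr1; lra.
  by move: m1 m2; lia.
by rewrite bE m0 mulr0 addr0 -aa'.
Qed.

Lemma roofE ab : farey_triangle ab ->
  roof (\pi_(coset_space SL2Z) (farey_mx ab)) = (ab.1 * ab.2)^-1.
Proof.
move=> Oab; rewrite /roof; case: xgetP => [r _ [ab' Oab' [/farey_mx_inj]]|].
  by move=> /(_ Oab Oab') <-.
by move=> /(_ (ab.1 * ab.2)^-1) []; exists ab.
Qed.

End farey.
Arguments farey_triangle {R}.
Arguments farey_mxs {R}.
Arguments farey_section {R}.
Arguments farey_mx {R} ab.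
Arguments roof {R} x.

Section finite_index.
Variables (R : realType) (H : groupClosed (SL2 R)).

(* Gamma/H, as a subset of G/H. *)
Definition Gamma_cosets : set (coset_space H) :=
  \pi_(coset_space H) @` [set g | g \in SL2Z].

(* [Gamma : H], meaningful if [Gamma_cosets] is finite. *)
Definition Gamma_index : nat := #|` fset_set Gamma_cosets |.

(* Gamma/H as a measurable space, with the discrete sigma-algebra. *)
Definition Gamma_quo : Type := set_type Gamma_cosets.

Fact Gamma_cosets1 : \pi_(coset_space H) 1%g \in Gamma_cosets.
Proof. by apply/mem_set; exists 1%g => //; exact: SL2Z_one. Qed.

HB.instance Definition _ := Choice.on Gamma_quo.
HB.instance Definition _ := isPointed.Build Gamma_quo
  (exist (fun x => x \in Gamma_cosets) _ Gamma_cosets1).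
HB.instance Definition _ := @isMeasurable.Build default_measure_display
  Gamma_quo discrete_measurable discrete_measurable0
  discrete_measurableC discrete_measurableU.

End finite_index.
Arguments Gamma_cosets {R} H.

Section haar.
Variables (R : realType) (H : groupClosed (SL2 R)).
Implicit Types mu : {measure set (coset_space H) -> \bar R}.
Local Open Scope ereal_scope.

(* Finite on compact sets, outer regular on Borel sets and inner regular on open
   sets; compact sets of [coset_space H] are closed when H is discrete. *)
Definition radon mu := [/\
  forall K, compact K -> mu K < +oo,
  forall B, measurable B ->
    mu B = ereal_inf [set mu U | U in [set U | open U /\ B `<=` U]] &
  forall U, open U ->
    mu U = ereal_sup [set mu K | K in [set K | compact K /\ K `<=` U]]].

Definition invariant_measure mu :=
  forall g B, measurable B -> mu (coset_act g @` B) = mu B.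

(* Invariance determines such a measure only up to a positive factor. *)
Definition haar mu :=
  [/\ radon mu, invariant_measure mu & mu [set: coset_space H] != 0].

End haar.

Section flow.
Variables (R : realType) (H : groupClosed (SL2 R)).
Implicit Types (S : set (coset_space H)) (x : coset_space H).

Definition hit_times S x : set R := [set s | S (coset_act (horo s) x)].

(* The last clause says that the set of hitting times is discrete. *)
Definition poincare_section (mu : {measure set (coset_space H) -> \bar R}) S :=
  {ae mu, forall x, [/\ hit_times S x !=set0, countable (hit_times S x) &
                        hit_times S x `<=` isolated (hit_times S x)]}.

Definition first_return S x (t : R) :=
  let T := [set s | 0 < s /\ hit_times S x s] in T t /\ lbound T t.

Definition is_return_time S (tau : coset_space H -> R) :=
  forall x, S x -> first_return S x (tau x).

Definition is_return_map S (r : coset_space H -> coset_space H) :=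
  forall x, S x -> exists2 t, first_return S x t & r x = coset_act (horo t) x.

End flow.

Section section_measure.
Variables (R : realType) (H : groupClosed (SL2 R)).

(* Omega'' = pi^-1(Omega') in G/H. *)
Definition lifted_section : set (coset_space H) :=
  @coset_proj R H @^-1` farey_section.

(* The parametrization of Omega'' by P x Gamma/H, P being itself parametrized by
   the Farey triangle. *)
Definition section_param (y : (R * R) * Gamma_quo H) : coset_space H :=
  coset_act (farey_mx y.1) (val y.2).

(* The measure 2 da db on the Farey triangle. *)
Definition farey_measure : set (R * R) -> \bar R :=
  mscale 2%:nng (mrestr (lebesgue_measure \x lebesgue_measure)%E
                        (@measurable_farey_triangle R)).

(* The measure mu_{Omega''}, as a measure on G/H concentrated on Omega''. *)
Definition section_measure : set (coset_space H) -> \bar R :=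
  pushforward (farey_measure \x @counting (Gamma_quo H) R)%E section_param.

(* The pairs (x, s) with x in Omega'' and 0 <= s < R(pi(x)). *)
Definition suspension : set (coset_space H * R) :=
  [set xs | lifted_section xs.1 /\ 0 <= xs.2 < roof (coset_proj xs.1)].

Definition suspension_flow (xs : coset_space H * R) : coset_space H :=
  coset_act (horo xs.2) xs.1.

End section_measure.
Arguments lifted_section {R} H.
Arguments section_param {R H} y.
Arguments section_measure {R} H.
Arguments suspension {R} H.
Arguments suspension_flow {R H} xs.

(* Main.v *)
Require Import Defs.
From HB Require Import structures.
From mathcomp Require Import all_boot all_order all_algebra generic_quotient.
From mathcomp Require Import all_classical all_reals all_analysis.
From mathcomp Require Import measurable_realfun finmap zify ring lra.
Set Implicit Arguments.
Unset Strict Implicit.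
Unset Printing Implicit Defensive.
Import Order.TTheory GRing.Theory Num.Theory.
Import numFieldNormedType.Exports.
Local Open Scope classical_set_scope.
Local Open Scope ring_scope.
Local Open Scope quotient_scope.

(** Write (a, b, s) for the coordinates of h_s p_{a,b}. In these coordinates the
    Haar measure of G is da db ds, and right multiplication by an element of Gamma
    gives h_{1/(ab)} p_{a,b} = p_{b,kb-a} (k 1; -1 0). Euclid's algorithm and this
    identity show that the points with (a, b) in the Farey triangle and
    0 <= s < 1/(ab), completed by a null set, form a strict fundamental domain for
    Gamma; all the claims on return times follow. Its volume, the integral of
    1/(ab) over the triangle, is the sum of the 1/n^2.

    For the measure, let sigma be the measurable section of G -> G/H given by the
    fundamental domain, lambda the Haar measure of G and nu(E) = lambda(sigma(E)).
    If mu is invariant and finite on compact sets, computing in two ways the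
    (mu x lambda)-measure of {(x, y) : x in E, y sigma(x) in sigma(G/H)} gives
    mu(E) nu(G/H) = nu(E) mu(G/H). Taking for E a compact set with nu(E) > 0 shows
    that mu is finite, hence that mu is proportional to nu, and nu is read off the
    coordinates (a, b, s). *)

(** * Entries, big cell coordinates *)

(** The orbits that miss Omega' cannot be thrown away at the outset: mu is only known to be
    invariant, and which sets are mu-null is learnt only from its comparison with nu. So sigma has
    to be defined on all of G/H, and this is why the fundamental domain must be strict and not
    merely correct up to a null set. The comparison exchanges two integrals, hence requires mu to be
    sigma-finite and sigma to be Borel. Both come from one exhaustion of the domain by compact sets:
    mu is finite on their images, and these images are closed because G/H is Hausdorff. The two
    slicings consume the full unimodularity of lambda: invariance under right and left translations
    and under inversion. Since a > 0 on the domain, it separates g from -g, and nu(G/H) =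
    [Gamma : H] pi^2/6; the prescribed mass is twice that, which accounts for the 2 in 2 da db. *)

Section SL2_entries.
Variable R : realType.
Implicit Types (g h : SL2 R) (a b c d s t : R).

Lemma lift00 : lift ord0 ord0 = 1 :> 'I_2. Proof. exact: val_inj. Qed.

Lemma ord2_01 (i : 'I_2) : i = 0 \/ i = 1.
Proof. by case: i => [[|[|//]] i2]; [left|right]; exact: val_inj. Qed.

Lemma SL2_eq g h : SL2val g 0 0 = SL2val h 0 0 -> SL2val g 0 1 = SL2val h 0 1 ->
  SL2val g 1 0 = SL2val h 1 0 -> SL2val g 1 1 = SL2val h 1 1 -> g = h.
Proof.
move=> h00 h01 h10 h11; apply: val_inj; apply/matrixP => i j.
by have [-> | ->] := ord2_01 i; have [-> | ->] := ord2_01 j.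
Qed.

Lemma SL2_mulE g h i j :
  SL2val (g * h)%g i j = SL2val g i 0 * SL2val h 0 j + SL2val g i 1 * SL2val h 1 j.
Proof.
by rewrite -[SL2val _]/(SL2val g *m SL2val h) !mxE !big_ord_recl big_ord0 addr0 lift00.
Qed.

Lemma SL2_detE g : SL2val g 0 0 * SL2val g 1 1 - SL2val g 0 1 * SL2val g 1 0 = 1.
Proof.
transitivity (\det (SL2val g)); last exact: det_SL2.
rewrite (expand_det_row _ 0) !big_ord_recl big_ord0 addr0.
rewrite /cofactor !det_mx11 !mxE /= !expr0 !mul1r expr1 mulN1r mulrN !lift00.
by have -> : lift 1 0 = ord0 :> 'I_2 by exact: val_inj.
Qed.

Section sl2_entries.
Variables a b c d : R.
Hypothesis abcd : a * d - b * c = 1.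
Lemma sl2_00 : SL2val (sl2 a b c d) 0 0 = a.
Proof. by rewrite -[SL2val _]/(val _) val_sl2// mxE. Qed.
Lemma sl2_01 : SL2val (sl2 a b c d) 0 1 = b.
Proof. by rewrite -[SL2val _]/(val _) val_sl2// mxE. Qed.
Lemma sl2_10 : SL2val (sl2 a b c d) 1 0 = c.
Proof. by rewrite -[SL2val _]/(val _) val_sl2// mxE. Qed.
Lemma sl2_11 : SL2val (sl2 a b c d) 1 1 = d.
Proof. by rewrite -[SL2val _]/(val _) val_sl2// mxE. Qed.
Definition sl2E := (sl2_00, sl2_01, sl2_10, sl2_11).
End sl2_entries.

Lemma SL2_invE g :
  g^-1%g = sl2 (SL2val g 1 1) (- SL2val g 0 1) (- SL2val g 1 0) (SL2val g 0 0).
Proof.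
have D := SL2_detE g; have D' : SL2val g 1 1 * SL2val g 0 0 - (- SL2val g 0 1) * (- SL2val g 1 0) = 1.
  by rewrite -D; ring.
apply/(mulgI g); rewrite mulgV; apply: SL2_eq; rewrite SL2_mulE !sl2E//= !mxE/=.
- by rewrite mulr1n -D; ring.
- by rewrite mulr0n; ring.
- by rewrite mulr0n; ring.
- by rewrite mulr1n -D; ring.
Qed.

Lemma horo_det s : 1 * 1 - 0 * - s = 1 :> R. Proof. by ring. Qed.

Lemma horoD s t : (horo s * horo t)%g = horo (s + t).
Proof.
by apply: SL2_eq; rewrite SL2_mulE !sl2E ?horo_det//; ring.
Qed.

Lemma horo0 : horo 0 = 1%g :> SL2 R.
Proof. by apply: (mulgI (horo 0)); rewrite horoD mulg1 addr0. Qed.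

(* The coordinates (a, b, s) of h_s p_{a,b}; meaningful only if a != 0. *)
Definition big_cell (q : R * R * R) : SL2 R := (horo q.2 * farey_mx q.1)%g.

Lemma farey_det a b : a != 0 -> a * a^-1 - b * 0 = 1.
Proof. by move=> a0; rewrite divff// mulr0 subr0. Qed.

Lemma big_cellE a b s : a != 0 ->
  big_cell (a, b, s) = sl2 a b (- s * a) (a^-1 - s * b).
Proof.
move=> a0; apply: SL2_eq; rewrite SL2_mulE !sl2E ?horo_det ?farey_det//=;
  by field.
Qed.

Lemma big_cell_det a b s : a != 0 -> a * (a^-1 - s * b) - b * (- s * a) = 1.
Proof. by move=> a0; field. Qed.

Definition cell_coord g : R * R * R :=
  (SL2val g 0 0, SL2val g 0 1, - SL2val g 1 0 / SL2val g 0 0).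

Lemma big_cellK a b s : a != 0 -> cell_coord (big_cell (a, b, s)) = (a, b, s).
Proof.
move=> a0; rewrite /cell_coord big_cellE// !sl2E ?big_cell_det//.
by congr (_, _, _); field.
Qed.

Lemma cell_coordK g : SL2val g 0 0 != 0 -> big_cell (cell_coord g) = g.
Proof.
move=> g0; rewrite /cell_coord big_cellE//.
have D := SL2_detE g.
have D' : SL2val g 1 1 = (SL2val g 0 0)^-1 - - SL2val g 1 0 / SL2val g 0 0 * SL2val g 0 1.
  apply: (mulfI g0); rewrite -[LHS](subrK (SL2val g 0 1 * SL2val g 1 0)) D; field => //.
by apply: SL2_eq; rewrite !sl2E ?big_cell_det// ?D'//; field.
Qed.

(** Left multiplication by [horo] commutes with right multiplication, so the increment of [s]
    depends on [(a, b)] only: the action is a skew translation over the linear action on the first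
    row. *)
Lemma big_cellM a b s (t u v w : R) : t * w - u * v = 1 ->
  a != 0 -> a * t + b * v != 0 ->
  (big_cell (a, b, s) * sl2 t u v w)%g =
  big_cell (a * t + b * v, a * u + b * w, s - v / (a * (a * t + b * v))).
Proof.
move=> tuvw a0 a'0.
rewrite -[LHS]cell_coordK; last first.
  by rewrite big_cellE// SL2_mulE !sl2E ?big_cell_det.
congr big_cell; rewrite /cell_coord big_cellE// !SL2_mulE !sl2E ?big_cell_det//.
by congr (_, _, _); field; rewrite a0 a'0.
Qed.

Lemma SL2Z_ints g : g \in SL2Z -> exists m n k l : int,
  [/\ SL2val g 0 0 = m%:~R, SL2val g 0 1 = n%:~R, SL2val g 1 0 = k%:~R,
      SL2val g 1 1 = l%:~R & m * l - n * k = 1].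
Proof.
rewrite inE /= => /mxOverP gZ.
have [[m mE] [n nE]] := (intrP (gZ 0 0), intrP (gZ 0 1)).
have [[k kE] [l lE]] := (intrP (gZ 1 0), intrP (gZ 1 1)).
exists m, n, k, l; split => //; apply: (@intr_inj R).
by rewrite rmorphB !rmorphM/= -mE -nE -kE -lE SL2_detE.
Qed.

Lemma SL2Z_sl2 (m n k l : int) : m * l - n * k = 1 ->
  sl2 m%:~R n%:~R k%:~R l%:~R \in @SL2Z R.
Proof.
move=> mnkl; rewrite inE val_sl2; last by rewrite -!intrM -intrB mnkl.
by apply/mxOverP => i j; rewrite mxE; do 2!case: ifP => _; exact: intr_int.
Qed.

End SL2_entries.

(** * The fundamental domain *)

Section fundamental_domain.
Variable R : realType.
Implicit Types (g h : SL2 R) (a b c d s t : R) (q : R * R * R).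

Definition fund_main : set (R * R * R) :=
  [set q | farey_triangle q.1 /\ 0 <= q.2 < (q.1.1 * q.1.2)^-1].

(* The orbits missing Omega': those of the lattices with a vertical primitive
   vector (0, 1/a), a > 1. Adding this null set makes [fund_dom] a fundamental
   domain in the strict sense. *)
Definition fund_cusp : set (R * R * R) :=
  [set q | [/\ 1 < q.1.1, q.1.2 = 0 & 0 <= q.2 < q.1.1 ^- 2]].

Definition fund_dom : set (R * R * R) := fund_main `|` fund_cusp.

Lemma fund_dom_gt0 q : fund_dom q -> 0 < q.1.1.
Proof.
by case=> [[[/andP[]]]//|[q1 _ _]]; exact: lt_trans q1.
Qed.

Lemma big_cell_mul a b s a' b' s' g : a != 0 -> a' != 0 ->
  big_cell (a', b', s') = (big_cell (a, b, s) * g)%g ->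
  [/\ a' = a * SL2val g 0 0 + b * SL2val g 1 0,
      b' = a * SL2val g 0 1 + b * SL2val g 1 1 &
      - s' * a' = - s * a * SL2val g 0 0 + (a^-1 - s * b) * SL2val g 1 0].
Proof.
move=> a0 a'0 E; have e i j : SL2val (big_cell (a', b', s')) i j =
  SL2val (big_cell (a, b, s) * g)%g i j by rewrite E.
have := e 0 0; have := e 0 1; have := e 1 0.
by rewrite !big_cellE// !SL2_mulE !sl2E ?big_cell_det// => -> -> ->.
Qed.

(* (a, c) and (b, d) are consecutive in slope, on both sides of the horizontal
   direction, among the lattice vectors with abscissa in ]0, 1]. *)
Lemma slope_le0 a b c d (m k : int) : 0 < a -> 0 < b -> 1 < a + b ->
  c <= 0 -> 0 < d -> a * m%:~R + b * k%:~R <= 1 ->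
  c * m%:~R + d * k%:~R <= 0 -> k <= 0.
Proof.
move=> a0 b0 ab c0 d0 x1 y0; rewrite leNgt; apply/negP => k0.
have {}k0 : 1 <= k%:~R :> R by rewrite ler1z.
(* If [m <= 0], then [c m + d k >= d k > 0]; otherwise [a m + b k >= a + b > 1]. *)
have [m0|m0] := leP m 0.
  have {}m0 : m%:~R <= 0 :> R by rewrite lerz0.
  nra.
have {}m0 : 1 <= m%:~R :> R by rewrite ler1z.
nra.
Qed.

(** The bounds [0 <= s] and [s < 1/(a b)] say that the first column of the matrix points weakly
    below the horizontal axis and the second strictly above it. *)
Lemma fund_main_slopes a b s : fund_main (a, b, s) ->
  [/\ 0 < a <= 1, 0 < b <= 1, 1 < a + b, - s * a <= 0 & 0 < a^-1 - s * b].
Proof.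
case=> -[/= /andP[a0 a1] /andP[b0 b1] ab] /andP[s0 s1].
rewrite a0 a1 b0 b1; split => //; first by nra.
by rewrite subr_gt0 -ltr_pdivlMr// -invfM.
Qed.

Lemma SL2Z_entries_inj g (m n k l : int) :
  SL2val g 0 0 = m%:~R -> SL2val g 0 1 = n%:~R -> SL2val g 1 0 = k%:~R ->
  SL2val g 1 1 = l%:~R -> m = 1 -> n = 0 -> k = 0 -> l = 1 -> g = 1%g.
Proof.
move=> gm gn gk gl m1 n0 k0 l1; apply: SL2_eq; rewrite ?gm ?gn ?gk ?gl.
- by rewrite m1 mxE.
- by rewrite n0 mxE.
- by rewrite k0 mxE.
- by rewrite l1 mxE.
Qed.

Lemma mulz_eq1 (m l : int) : 0 < m -> m * l = 1 -> m = 1 /\ l = 1.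
Proof.
move=> m0 ml; have l0 : 0 < l by rewrite -(pmulr_rgt0 _ m0) ml.
by split; nia.
Qed.

(** Two Farey bases of one lattice share their first column, because [slope_le0] applies to [g] and
    to its inverse; then [b] and [b'] lie in ]1 - a, 1] and differ by a multiple of [a]. A cusp
    lattice has its abscissas in [a Z] with [a > 1], so it contains no vector of a Farey basis. Two
    cusp bases differ by a lower unipotent, which changes [s a^2] by an integer. *)
Lemma fund_dom_inj q q' g : fund_dom q -> fund_dom q' -> g \in SL2Z ->
  big_cell q' = (big_cell q * g)%g -> q = q' /\ g = 1%g.
Proof.
move=> Dq Dq' gZ e.
suff g1 : g = 1%g.
  split=> //; move: e; rewrite g1 mulg1 => e.
  have := fund_dom_gt0 Dq; have := fund_dom_gt0 Dq'.
  case: q q' e {Dq Dq'} => [[a b] s] [[a' b'] s'] e /= a'0 a0.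
  by rewrite -(big_cellK b s (lt0r_neq0 a0)) -(big_cellK b' s' (lt0r_neq0 a'0)) e.
have e' : big_cell q = (big_cell q' * g^-1)%g by rewrite e mulgK.
have a0 := fund_dom_gt0 Dq; have a'0 := fund_dom_gt0 Dq'.
have [m [n [k [l [gm gn gk gl mnkl]]]]] := SL2Z_ints gZ.
have [Vm Vn Vk Vl] : [/\ SL2val g^-1%g 0 0 = l%:~R, SL2val g^-1%g 0 1 = - n%:~R,
   SL2val g^-1%g 1 0 = - k%:~R & SL2val g^-1%g 1 1 = m%:~R].
  have D : SL2val g 1 1 * SL2val g 0 0 - (- SL2val g 0 1) * (- SL2val g 1 0) = 1.
    by rewrite -(SL2_detE g); ring.
  by rewrite SL2_invE !sl2E// gm gn gk gl.
case: q q' => [[a b] s] [[a' b'] s'] /= in Dq Dq' e e' a0 a'0 *.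
have [a'E b'E s'E] := big_cell_mul (lt0r_neq0 a0) (lt0r_neq0 a'0) e.
have [aE bE sE] := big_cell_mul (lt0r_neq0 a'0) (lt0r_neq0 a0) e'.
rewrite gm gn gk gl in a'E b'E s'E; rewrite Vm Vn Vk Vl in aE bE sE.
case: Dq Dq' => [Dq|[/= a1 b0 /andP[s0 s1]]] [Dq'|[/= a'1 b'0 /andP[s'0 s'1]]].
- have [/andP[_ a1] /andP[b0 b1] ab c0 d0] := fund_main_slopes Dq.
  have [/andP[_ a'1] /andP[b'0 b'1] ab' c'0 d'0] := fund_main_slopes Dq'.
  have k0 : k <= 0.
    by apply: (slope_le0 (m := m) a0 b0 ab c0 d0); rewrite -?a'E// -s'E.
  have k0' : - k <= 0.
    apply: (slope_le0 (m := l) a'0 b'0 ab' c'0 d'0);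
      by rewrite rmorphN/= -?aE// -sE.
  have kE : k = 0 by clear -k0 k0'; lia.
  rewrite kE in a'E s'E mnkl.
  have m0 : 0 < m.
    by rewrite -(ltr0z R) -(pmulr_rgt0 _ a0); move: a'0; rewrite a'E; lra.
  have [m1 l1] : m = 1 /\ l = 1 by apply: mulz_eq1; rewrite // -mnkl mulr0 subr0.
  have aa' : a' = a by rewrite a'E m1; lra.
  have bb' : b' = a * n%:~R + b by rewrite b'E l1; lra.
  have n1 : n < 1 by rewrite -(ltr_int R) -(ltr_pM2l a0); lra.
  have n2 : -1 < n by rewrite -(ltr_int R) -(ltr_pM2l a0); lra.
  have n0 : n = 0 by clear -n1 n2; lia.
  exact: (SL2Z_entries_inj gm gn gk gl).
- exfalso; have [/andP[_ a1] /andP[b0 b1] ab c0 d0] := fund_main_slopes Dq.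
  move: aE; rewrite b'0 mul0r addr0 => aE.
  have l0 : 0 < l by rewrite -(ltr0z R) -(pmulr_rgt0 _ a'0) -aE.
  have : 1 <= l%:~R :> R by rewrite ler1z.
  nra.
- exfalso; have [/andP[_ a'1] /andP[b'0 b'1] ab c'0 d'0] := fund_main_slopes Dq'.
  move: a'E; rewrite b0 mul0r addr0 => a'E.
  have l0 : 0 < m by rewrite -(ltr0z R) -(pmulr_rgt0 _ a0) -a'E.
  have : 1 <= m%:~R :> R by rewrite ler1z.
  nra.
- have n0 : n = 0.
    apply/eqP; rewrite -(intr_eq0 R); move: b'E.
    by rewrite b'0 b0 mul0r addr0 => /esym/eqP; rewrite mulf_eq0 gt_eqF.
  have m0 : 0 < m.
    by rewrite -(ltr0z R) -(pmulr_rgt0 _ a0); move: a'0; rewrite a'E b0; lra.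
  have [m1 l1] : m = 1 /\ l = 1 by apply: mulz_eq1; rewrite // -mnkl n0 mul0r subr0.
  have aa' : a' = a by rewrite a'E m1 b0; lra.
  have ss' : k%:~R = (s - s') * a ^+ 2.
    apply: (mulfI (invr_neq0 (lt0r_neq0 a0))).
    move: s'E; rewrite aa' m1 b0 mulr0 subr0 mulr1 => /eqP.
    rewrite addrC -subr_eq => /eqP <-; field; exact: lt0r_neq0.
  have a2 : 0 < a ^+ 2 by rewrite exprn_gt0.
  have sa : s * a ^+ 2 < 1 by rewrite -ltr_pdivlMr// mul1r.
  have sa' : s' * a ^+ 2 < 1 by rewrite -aa' -ltr_pdivlMr ?aa'// mul1r -aa'.
  have k1 : k < 1 by rewrite -(ltr_int R) ss'; nra.
  have k2 : -1 < k by rewrite -(ltr_int R) ss'; nra.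
  have k0 : k = 0 by clear -k1 k2; lia.
  exact: (SL2Z_entries_inj gm gn gk gl).
Qed.

End fundamental_domain.

(** * Reduction of G to the fundamental domain *)

Section reduction.
Variable R : realType.
Implicit Types (g h : SL2 R) (a b c d s t : R) (q : R * R * R).

Definition return_sl2 (k : R) : SL2 R := sl2 k 1 (- 1) 0.

Lemma return_det (k : R) : k * 0 - 1 * (- 1) = 1. Proof. by ring. Qed.

Lemma return_sl2Z (k : int) : return_sl2 k%:~R \in SL2Z.
Proof.
rewrite /return_sl2.
by have := @SL2Z_sl2 R k 1 (-1) 0; rewrite rmorphN1; apply; ring.
Qed.

(** An identity in G for every real [k]; the integer [k] is selected only to bring [(b, k b - a)]
    back into the triangle. *)
Lemma big_cell_return (k : R) a b s : a != 0 -> b != 0 ->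
  big_cell (a, b, s) =
  (big_cell (b, k * b - a, s - (a * b)^-1) * return_sl2 k)%g.
Proof.
move=> a0 b0; have e : b * k + (k * b - a) * -1 = a by ring.
rewrite big_cellM ?return_det// e//.
by congr (big_cell (_, _, _)); field; rewrite ?a0.
Qed.

(** [k] is the largest integer with [k b - a <= 1], hence [k b - a > 1 - b >= 0]. *)
Lemma farey_return a b : farey_triangle (a, b) ->
  farey_triangle (b, (Num.floor ((1 + a) / b))%:~R * b - a).
Proof.
case=> /= /andP[a0 a1] /andP[b0 b1] ab; set k := Num.floor _.
have : k%:~R * b <= 1 + a by rewrite -ler_pdivlMr// floor_le.
have : 1 + a < (k%:~R + 1) * b.
  by rewrite -ltr_pdivrMr// -[1 in X in _ < X]/(1%:~R) -intrD floorD1_gt.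
rewrite mulrDl mul1r => k1 k2; split => /=; first by rewrite b0.
  by apply/andP; split; lra.
by lra.
Qed.

(** The reflection [(a, b) -> (b, a)] of the triangle conjugates the return map to its inverse, so
    this point is the preimage of [(a, b)]. *)
Lemma farey_return_inv a b : farey_triangle (a, b) ->
  farey_triangle ((Num.floor ((1 + b) / a))%:~R * a - b, a).
Proof.
case=> /= a01 b01 ab; have ab' : farey_triangle (b, a) by split; rewrite //= addrC.
by have [/= ? ? ?] := farey_return ab'; split; rewrite //= addrC.
Qed.

Lemma farey_gt0 a b : farey_triangle (a, b) -> 0 < a /\ 0 < b.
Proof. by case=> /= /andP[a0 _] /andP[b0 _]. Qed.

Lemma farey_roof_ge1 a b : farey_triangle (a, b) -> 1 <= (a * b)^-1.
Proof.
case=> /= /andP[a0 a1] /andP[b0 b1] ab.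
by rewrite invf_ge1 ?mulr_gt0// mulr_ile1// ltW.
Qed.

Definition reducible g :=
  exists2 q, fund_dom q & exists2 h, h \in SL2Z & g = (big_cell q * h)%g.

Lemma reducibleM g h : h \in SL2Z -> reducible (g * h)%g -> reducible g.
Proof.
move=> hZ [q Dq [k kZ e]]; exists q => //; exists (k * h^-1)%g.
  by rewrite gpredM// gpredVr.
by rewrite mulgA -e mulgK.
Qed.

Lemma reducible_fund q : fund_dom q -> reducible (big_cell q).
Proof. by move=> Dq; exists q => //; exists 1%g; rewrite ?mulg1// gpred1. Qed.

Lemma reducible_farey_ge0 n a b s : farey_triangle (a, b) ->
  0 <= s -> s <= n%:R -> reducible (big_cell (a, b, s)).
Proof.
elim: n a b s => [|n ih] a b s Oab s0 sn; have [a0 b0] := farey_gt0 Oab;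
    have r1 := farey_roof_ge1 Oab.
  apply: reducible_fund; left; split => //=; rewrite s0/=.
  by apply: le_lt_trans sn _; rewrite invr_gt0 mulr_gt0.
have [sr|sr] := ltP s (a * b)^-1.
  by apply: reducible_fund; left; split => //=; rewrite s0.
set k := Num.floor ((1 + a) / b).
rewrite (big_cell_return k%:~R) ?gt_eqF//.
apply: (@reducibleM _ (return_sl2 k%:~R)^-1%g); first by rewrite gpredVr ?return_sl2Z.
rewrite mulgK; apply: ih; first exact: farey_return.
  by rewrite subr_ge0.
by move: sn; rewrite -natr1; lra.
Qed.

Lemma reducible_farey_le0 n a b s : farey_triangle (a, b) ->
  s <= 0 -> - s <= n%:R -> reducible (big_cell (a, b, s)).
Proof.
elim: n a b s => [|n ih] a b s Oab s0 sn.
  by apply: (@reducible_farey_ge0 0) => //; lra.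
move: s0; rewrite le_eqVlt => /predU1P[->|s0].
  by apply: (@reducible_farey_ge0 0); rewrite ?lexx.
have [a0 b0] := farey_gt0 Oab.
have := farey_return_inv Oab; set k := Num.floor _; set a' := _ - b => Oa'.
have [a'0 _] := farey_gt0 Oa'; have r1 := farey_roof_ge1 Oa'.
apply: (@reducibleM _ (return_sl2 k%:~R)); first exact: return_sl2Z.
have -> : (big_cell (a, b, s) * return_sl2 k%:~R)%g
    = big_cell (a', a, s + (a' * a)^-1).
  rewrite (@big_cell_return k%:~R a' a) ?gt_eqF//; congr (big_cell (_, _, _) * _)%g.
    by rewrite /a'; ring.
  by rewrite addrK.
have [s'0|s'0] := ltP 0 (s + (a' * a)^-1).
  apply: reducible_fund; left; split => //=; rewrite ltW//=.
  by lra.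
by apply: ih => //; move: sn; rewrite -natr1; lra.
Qed.

Lemma reducible_farey a b s : farey_triangle (a, b) ->
  reducible (big_cell (a, b, s)).
Proof.
move=> Oab; have [s0|s0] := leP 0 s.
  by apply: (reducible_farey_ge0 (n := Num.bound s)); rewrite // ltW// archi_boundP.
apply: (reducible_farey_le0 (n := Num.bound (- s))); rewrite // ltW//.
by rewrite archi_boundP// oppr_ge0 ltW.
Qed.

Lemma reducible_shear (m : int) a b s : a != 0 ->
  reducible (big_cell (a, b + m%:~R * a, s)) -> reducible (big_cell (a, b, s)).
Proof.
move=> a0 r; apply: (@reducibleM _ (sl2 1 m%:~R 0 1)).
  by apply: (@SL2Z_sl2 R 1 m 0 1); ring.
rewrite big_cellM ?mulr0 ?addr0 ?mulr1 ?subr0//.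
by rewrite mul0r subr0 addrC (mulrC a).
Qed.

Lemma reducible_le1 a b s : 0 < a <= 1 -> reducible (big_cell (a, b, s)).
Proof.
(* [b + m a] is the translate of [b] that falls into ]1 - a, 1]. *)
move=> /andP[a0 a1]; set m := Num.floor ((1 - b) / a).
apply: (@reducible_shear m); first by rewrite gt_eqF.
apply: reducible_farey.
have : m%:~R * a <= 1 - b by rewrite -ler_pdivlMr// floor_le.
have : 1 - b < (m%:~R + 1) * a.
  by rewrite -ltr_pdivrMr// -[1 in X in _ < X]/(1%:~R) -intrD floorD1_gt.
rewrite mulrDl mul1r => k1 k2; split => /=; first by rewrite a0.
  by apply/andP; split; lra.
by lra.
Qed.

Lemma reducible_cusp a s : 1 < a -> reducible (big_cell (a, 0, s)).
Proof.
move=> a1; have a0 : 0 < a by exact: lt_trans a1.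
have a20 : 0 < a ^+ 2 by rewrite exprn_gt0.
(* When [b = 0], integral lower unipotents shift [s] by multiples of [1/a^2]. *)
set k := Num.floor (s * a ^+ 2).
apply: (@reducibleM _ (sl2 1 0 k%:~R 1)).
  by apply: (@SL2Z_sl2 R 1 0 k 1); ring.
rewrite big_cellM ?mul0r ?mulr0 ?addr0 ?mulr1 ?subr0// ?gt_eqF//.
apply: reducible_fund; right; split => //=; rewrite -expr2.
apply/andP; split.
  by rewrite subr_ge0 ler_pdivrMr// floor_le.
rewrite ltrBlDr -[X in _ < X + _]mul1r -mulrDl ltr_pdivlMr// addrC.
by rewrite -[1 in X in _ < X]/(1%:~R) -intrD floorD1_gt.
Qed.

(** Euclid's algorithm on reals need not stop, so the step is chosen by the size of the remainder
    [b'] of [b] modulo [a]. If [b' <= a - 1], exchanging the columns lowers [a] by at least 1;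
    otherwise [0 < a - b' < 1], and [a - b'] as new [a] ends the descent. *)
Lemma reducible_gt0 n a b s : 0 < a -> a <= n%:R -> reducible (big_cell (a, b, s)).
Proof.
elim: n a b s => [|n ih] a b s a0 an; first by move: an; rewrite leNgt a0.
have [a1|a1] := leP a 1; first by apply: reducible_le1; rewrite a0.
apply: (@reducible_shear (- Num.floor (b / a))); first by rewrite gt_eqF.
set m := Num.floor _; set b' := b + _.
have b'0 : 0 <= b'.
  by rewrite /b' rmorphN/= mulNr subr_ge0 -ler_pdivlMr// floor_le.
have b'a : b' < a.
  rewrite /b' rmorphN/= mulNr ltrBlDr -[X in X + _]mul1r -mulrDl -ltr_pdivrMr//.
  by rewrite addrC -[1 in X in _ < X]/(1%:~R) -intrD floorD1_gt.
move: b'0; rewrite le_eqVlt => /predU1P[<-|b'0]; first exact: reducible_cusp.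
have [b'n|b'n] := leP b' (a - 1).
  apply: (@reducibleM _ (sl2 0 (- 1) 1 0)).
    by have := @SL2Z_sl2 R 0 (-1) 1 0; rewrite rmorphN1; apply; ring.
  rewrite big_cellM ?gt_eqF//; try by rewrite ?mulr0 ?mulr1 ?add0r// ?gt_eqF//; ring.
  by apply: ih; rewrite ?mulr0 ?mulr1 ?add0r//; move: an; rewrite -natr1; lra.
apply: (@reducibleM _ (sl2 1 0 (- 1) 1)).
  by have := @SL2Z_sl2 R 1 0 (-1) 1; rewrite rmorphN1; apply; ring.
have ab : a * 1 + b' * -1 = a - b' by ring.
rewrite big_cellM ?ab ?gt_eqF// ?subr_gt0//; last by ring.
by apply: reducible_le1; apply/andP; split; lra.
Qed.

(* Euclid's algorithm on (a, b) brings a into ]0, 1] or b to 0; in the first case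
   one reaches the Farey triangle, where each step of the return map or of its
   inverse moves s by 1 / (a b) >= 1 towards its range. *)
Lemma SL2_reducible g : reducible g.
Proof.
have red0 h : 0 < SL2val h 0 0 -> reducible h.
  move=> h0; rewrite -[h]cell_coordK ?gt_eqF//.
  by apply: (reducible_gt0 (n := Num.bound (SL2val h 0 0))); rewrite // ltW// archi_boundP// ltW.
have red1 h : SL2val h 0 0 != 0 -> reducible h.
  rewrite neq_lt => /orP[h0|]; last exact: red0.
  apply: (@reducibleM _ (sl2 (- 1) 0 0 (- 1))).
    by have := @SL2Z_sl2 R (-1) 0 0 (-1); rewrite rmorphN1; apply; ring.
  by apply: red0; rewrite SL2_mulE !sl2E; [rewrite mulr0 addr0 mulrN1 oppr_gt0|ring..].
have [g0|] := eqVneq (SL2val g 0 0) 0; last exact: red1.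
apply: (@reducibleM _ (sl2 0 (- 1) 1 0)).
  by have := @SL2Z_sl2 R 0 (-1) 1 0; rewrite rmorphN1; apply; ring.
apply: red1; rewrite SL2_mulE !sl2E; [|ring..].
have := SL2_detE g; rewrite g0 mul0r !mulr0 mulr1 add0r.
have [->|g1 _] := eqVneq (SL2val g 0 1) 0; last by rewrite add0r.
by rewrite mul0r oppr0 => /eqP; rewrite eq_sym oner_eq0.
Qed.

End reduction.

(** * Topology and Borel sets of G/H *)

Section SL2_topology.
Variable R : realType.
Implicit Types (g h : SL2 R) (a b c d s t : R) (q : R * R * R).

Lemma SL2_entry_continuous i j : continuous (fun g : SL2 R => SL2val g i j).
Proof.
move=> g; apply: (@continuous_comp _ _ _ (val : SL2 R -> 'M[R]_2)
  (fun M : 'M[R]_2 => M i j)).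
  exact: (@initial_continuous _ _ (val : SL2 R -> 'M[R]_2)).
exact: coord_continuous.
Qed.

Lemma cvg_SL2_entry (T : Type) (F : set_system T) {FF : Filter F}
  (f : T -> SL2 R) g i j : f x @[x --> F] --> g ->
  SL2val (f x) i j @[x --> F] --> SL2val g i j.
Proof.
move=> fg; apply: (@cvg_comp _ _ _ f (fun g => SL2val g i j) _ _ _ fg).
exact: SL2_entry_continuous.
Qed.

Lemma cvg_SL2 (T : Type) (F : set_system T) {FF : Filter F} (f : T -> SL2 R) g :
  (forall i j, SL2val (f x) i j @[x --> F] --> SL2val g i j) ->
  f x @[x --> F] --> g.
Proof.
move=> fg A; rewrite nbhsE => -[_ [[C oC <-] Cg] CA].
apply: filterS CA _; rewrite /= nbhs_simpl.
have : nbhs (SL2val g) C by exact: open_nbhs_nbhs.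
case=> P Pg PC.
have : \forall x \near F, forall i j, P i j (SL2val (f x) i j).
  apply: filter_forall => i; apply: filter_forall => j.
  exact: fg (Pg i j).
by apply: filterS => x Px; exact: PC.
Qed.

Lemma SL2_mul_cvg (T : Type) (F : set_system T) {FF : Filter F}
  (f h : T -> SL2 R) g k : f x @[x --> F] --> g -> h x @[x --> F] --> k ->
  (f x * h x)%g @[x --> F] --> (g * k)%g.
Proof.
move=> fg hk; apply: cvg_SL2 => i j; rewrite SL2_mulE.
under eq_fun do rewrite SL2_mulE.
by apply: cvgD; apply: cvgM; exact: cvg_SL2_entry.
Qed.

Lemma SL2_inv_continuous : continuous (fun g : SL2 R => g^-1%g).
Proof.
move=> g; apply: (cvg_SL2 (FF := nbhs_filter g)) => i j.
have E h : SL2val h^-1%g i j = if i == 0 then if j == 0 then SL2val h 1 1 else - SL2val h 0 1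
    else if j == 0 then - SL2val h 1 0 else SL2val h 0 0.
  have D : SL2val h 1 1 * SL2val h 0 0 - (- SL2val h 0 1) * (- SL2val h 1 0) = 1.
    by rewrite -(SL2_detE h); ring.
  rewrite SL2_invE.
  by have [-> | ->] := ord2_01 i; have [-> | ->] := ord2_01 j; rewrite !sl2E.
rewrite E; under eq_fun do rewrite E.
by case: ifP => _; case: ifP => _; try apply: cvgN; exact: SL2_entry_continuous.
Qed.

Lemma SL2_inv_cvg (T : Type) (F : set_system T) {FF : Filter F}
  (f : T -> SL2 R) g : f x @[x --> F] --> g ->
  (f x)^-1%g @[x --> F] --> g^-1%g.
Proof.
move=> fg; apply: (@cvg_comp _ _ _ f (fun g => g^-1%g) _ _ _ fg).
exact: SL2_inv_continuous.
Qed.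

Lemma SL2_mulr_continuous h : continuous (fun g => (g * h)%g).
Proof.
move=> g; apply: (@SL2_mul_cvg _ _ (nbhs_filter g) id (fun=> h) g h).
  exact: cvg_id.
exact: (@cvg_cst (SL2 R)).
Qed.

Lemma SL2_ldiv_cvg g h : (p.1^-1 * p.2)%g @[p --> (g, h)] --> (g^-1 * h)%g.
Proof.
have FF : Filter (nbhs (g, h)) := nbhs_filter (g, h).
apply: (@SL2_mul_cvg _ _ FF (fun p => p.1^-1%g) snd g^-1%g h).
  by apply: (@SL2_inv_cvg _ _ FF fst g); exact: cvg_fst.
exact: cvg_snd.
Qed.

(** The interval ]ceil r - 1, floor r + 1[ contains no integer except possibly [r] itself. *)
Lemma near_int_eq (r : R) : \forall t \near r, t \is a Num.int -> t = r.
Proof.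
have : r \in `](Num.ceil r)%:~R - 1, (Num.floor r)%:~R + 1[.
  rewrite in_itv/=; have := floorD1_gt r; have := ceilB1_lt r.
  by rewrite intrB intrD => -> ->.
move/near_in_itvoo; apply: filterS => t; rewrite in_itv/=.
move=> /[swap] /intrP[m ->]; rewrite -(intrB _ _ 1) -(intrD _ _ 1) !ltr_int.
move=> /andP[m1 m2].
apply/eqP; rewrite eq_le; apply/andP; split.
  by rewrite -floor_ge_int -ltzD1.
by rewrite -ceil_le_int -ltzD1 -ltrBlDr.
Qed.

(** As [g] is arbitrary, this says that Gamma is closed as well as discrete. *)
Lemma near_SL2Z g : \forall h \near g, h \in SL2Z -> h = g.
Proof.
have : \forall h \near g, forall i j, SL2val h i j \is a Num.int ->
    SL2val h i j = SL2val g i j.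
  apply: (@filter_forall _ _ _ _ (nbhs_filter g)) => i.
  apply: (@filter_forall _ _ _ _ (nbhs_filter g)) => j.
  have := @SL2_entry_continuous i j g _ (near_int_eq (SL2val g i j)).
  by rewrite /= nbhs_simpl.
apply: filterS => h hg; rewrite inE => /mxOverP hZ.
by apply: val_inj; apply/matrixP => i j; exact: hg (hZ _ _).
Qed.

End SL2_topology.

Section coset_topology.
Variables (R : realType) (H : groupClosed (SL2 R)).
Implicit Types (g h : SL2 R) (x y : coset_space H).
Local Notation pi := (\pi_(coset_space H)).

Lemma coset_pi_continuous : continuous (fun g : SL2 R => pi g).
Proof. exact: (@pi_continuous (SL2 R) {eq_quot coset_equiv H}). Qed.

Lemma coset_pi_open (U : set (SL2 R)) : open U ->
  open ((fun g => pi g) @` U : set (coset_space H)).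
Proof.
move=> oU; rewrite /open/= /quotient_open.
rewrite (_ : _ @^-1` _ = \bigcup_(h in [set h | h \in H]) [set g | U (g * h)%g]).
  apply: bigcup_open => h _; apply: (open_comp (f := fun g => (g * h)%g)) => //.
  by move=> g _; exact: SL2_mulr_continuous.
apply/seteqP; split => g /=.
  by move=> [k Uk /esym/coset_eqP kg]; exists (g^-1 * k)%g => //=; rewrite mulVKg.
move=> [h hH Ugh]; exists (g * h)%g => //; apply/coset_eqP.
by rewrite invgM mulgVK gpredVr.
Qed.

(** H is closed, being contained in Gamma, so [u^-1 v] avoids H for [(u, v)] in a product
    neighbourhood of [(g, k)]; the open map onto G/H sends its two factors to disjoint open sets.
    This is what makes compact sets closed, hence Borel. *)
Lemma coset_space_hausdorff : {subset H <= SL2Z} -> hausdorff_space (coset_space H).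
Proof.
move=> HZ; rewrite open_hausdorff => x y.
rewrite -[x]reprK -[y]reprK; set g := repr x; set k := repr y => gk.
have nH : (g^-1 * k)%g \notin H.
  by apply: contra gk => gkH; apply/eqP/coset_eqP.
have : \forall p \near (g, k), (p.1^-1 * p.2)%g \notin H.
  have gkc : (p.1^-1 * p.2)%g @[p --> (g, k)] --> (g^-1 * k)%g.
    exact: SL2_ldiv_cvg.
  have := gkc _ (near_SL2Z (g^-1 * k)%g).
  apply: (@filterS _ (nbhs (g, k)) (nbhs_filter (g, k))) => p /= pE.
  apply/negP => pH; move/negP: nH; apply.
  by rewrite -(pE (HZ _ pH)).
case=> -[U V] /= []; rewrite !nbhsE => -[U' [oU' U'g] U'U] [V' [oV' V'k] V'V] UV.
exists ((fun g => pi g) @` U', (fun g => pi g) @` V').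
  by split; apply/mem_set; [exists g|exists k].
split; [exact: coset_pi_open..|].
apply/eqP/seteqP; split => // z [[u Uu <-] [v Vv]] /esym/coset_eqP uv.
have := UV (u, v) (conj (U'U _ Uu) (V'V _ Vv)).
by rewrite /= uv.
Qed.

Lemma open_coset_measurable (U : set (coset_space H)) : open U -> measurable U.
Proof. exact: sub_sigma_algebra. Qed.

Lemma closed_coset_measurable (K : set (coset_space H)) : closed K -> measurable K.
Proof.
move=> cK; rewrite -[K]setCK; apply: measurableC.
by apply: open_coset_measurable; rewrite openC.
Qed.

End coset_topology.

(** * Borel sets of R^3 *)

Section real3.
Variable R : realType.

(** Measurability here refers to the product sigma-algebra, so [U] is exhibited as a countable union
    of boxes with rational centres and radii 1/(n+1). *)
Lemma open3_measurable (U : set (R * R * R)) : open U -> measurable U.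
Proof.
move=> oU.
pose B (i : rat * rat * rat * nat) : set (R * R * R) :=
  let e := i.2.+1%:R^-1 in
  (ball (ratr i.1.1.1 : R) e `*` ball (ratr i.1.1.2 : R) e) `*` ball (ratr i.1.2 : R) e.
rewrite (_ : U = \bigcup_(i in [set i | B i `<=` U]) B i).
  rewrite bigcup_mkcond; apply: countable_bigcupT_measurable => [|i].
    exact: countableP.
  case: ifP => _; last exact: measurable0.
  apply: measurableX; first apply: measurableX;
  exact: measurable_realfun.measurable_ball.
apply/seteqP; split => [p Up|p [i /= BU /BU //]].
have : nbhs p U by exact: open_nbhs_nbhs.
move=> /nbhs_ballP[e /= e0 eU].
(* With radius below [e / 2], any such box that contains [p] stays within distance [e] of [p]. *)
have [n ne] : exists n : nat, n.+1%:R^-1 < e / 2.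
  exists (Num.bound (e / 2)^-1).
  rewrite invf_plt ?posrE ?divr_gt0//.
  apply: lt_le_trans (archi_boundP _) _; last by rewrite ler_nat.
  by rewrite invr_ge0 divr_ge0// ltW.
have n0 : (0 : R) < n.+1%:R^-1 by rewrite invr_gt0.
have : forall i : rat * rat * rat, B (i, n) =
    (ball (ratr i.1.1 : R) n.+1%:R^-1 `*` ball (ratr i.1.2 : R) n.+1%:R^-1)
    `*` ball (ratr i.2 : R) n.+1%:R^-1 by [].
move: B (n.+1%:R^-1 : R) ne n0 => B d de d0 BE.
have ratball (r : R) : exists c : rat, ball (ratr c : R) d r.
  have rr : r - d < r + d by lra.
  have [c] := rat_in_itvoo rr.
  rewrite in_itv/= => /andP[c1 c2]; exists c; rewrite /ball/= ltr_distlC; apply/andP; split; lra.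
case: p Up eU => -[a b] s Up eU.
have [[[a' a'P] [b' b'P]] [s' s'P]] := (ratball a, ratball b, ratball s).
apply: (ex_intro2 _ _ (a', b', s', n)); last first.
  by rewrite [in X in X _]BE; do !split.
rewrite /mkset BE => -[[a2 b2] s2] [/= [a2P b2P] s2P]; apply: eU.
have tri (r c r' : R) : ball c d r -> ball c d r' -> ball r e r'.
  rewrite /ball/= => h1 h2.
  rewrite [e]splitr (le_lt_trans (ler_distD c _ _))// ltrD//.
    by rewrite distrC (lt_trans h1).
  by rewrite (lt_trans h2).
by split; [split|]; [exact: tri a'P _|exact: tri b'P _|exact: tri s'P _].
Qed.

End real3.

(** * Coordinates on G/H *)

Section chart.
Variables (R : realType) (H : groupClosed (SL2 R)).
Implicit Types (g h : SL2 R) (x : coset_space H) (v : Gamma_quo H) (q : R * R * R).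
Local Notation pi := (\pi_(coset_space H)).

(** Over [fund_dom] it becomes a bijection onto G/H: the three reals locate the point of G/Gamma,
    the element of Gamma/H the sheet above it. *)
Definition chart (y : (R * R * R) * Gamma_quo H) : coset_space H :=
  coset_act (big_cell y.1) (val y.2).

Lemma Gamma_quoP v : exists2 g, g \in SL2Z & val v = pi g.
Proof. by have /set_mem[g gZ <-] := valP v; exists g. Qed.

Definition Gamma_pi g (gZ : g \in SL2Z) : Gamma_quo H :=
  exist (fun x => x \in Gamma_cosets H) (pi g)
    (mem_set (ex_intro2 _ _ g gZ erefl)).

Lemma chart_pi q v g : val v = pi g -> chart (q, v) = pi (big_cell q * g)%g.
Proof. by move=> vg; rewrite /chart/= vg coset_actE. Qed.

Lemma chart_surj x : exists y, fund_dom y.1 /\ chart y = x.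
Proof.
have [q Dq [h hZ gE]] := SL2_reducible (repr x).
exists (q, Gamma_pi hZ); split => //.
by rewrite (@chart_pi _ _ h)// -gE reprK.
Qed.

(** The two big cell elements differ by an element of Gamma, which strictness of the domain forces
    to be 1; the cosets in Gamma/H then agree. *)
Lemma chart_inj (HZ : {subset H <= SL2Z}) y y' : fund_dom y.1 -> fund_dom y'.1 ->
  chart y = chart y' -> y = y'.
Proof.
case: y y' => [q v] [q' v'] /= Dq Dq'.
have [[g gZ vg] [g' gZ' vg']] := (Gamma_quoP v, Gamma_quoP v').
rewrite (chart_pi _ vg) (chart_pi _ vg') => /coset_eqP; set h := (_ * _)%g => hH.
have e : (big_cell q * g * h = big_cell q' * g')%g by rewrite /h mulVKg.
have e' : big_cell q' = (big_cell q * (g * h * g'^-1))%g.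
  by move: (big_cell q) (big_cell q') h e {hH} => k k' h e; rewrite !mulgA e mulgK.
have kZ : (g * h * g'^-1)%g \in SL2Z.
  by rewrite gpredM ?gpredVr// gpredM// HZ.
have [-> k1] := fund_dom_inj Dq Dq' kZ e'.
congr (_, _); apply: val_inj; rewrite /= vg vg'; apply/coset_eqP.
have -> : g' = (g * h)%g by apply: (mulIg g'^-1%g); rewrite k1 mulgV.
by rewrite mulKg.
Qed.

Lemma chart_cvg q v : q.1.1 != 0 -> chart (p, v) @[p --> q] --> chart (q, v).
Proof.
case: q => [[a b] s] /= a0; have [g gZ vg] := Gamma_quoP v.
rewrite (chart_pi _ vg).
rewrite (_ : (fun p => chart (p, v)) = (fun p => pi (big_cell p * g)%g)); last first.
  by apply/funext => p; exact: chart_pi.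
have FF : Filter (nbhs (a, b, s)) := nbhs_filter _.
apply: (@cvg_comp _ _ _ (fun p => big_cell p * g)%g (fun g : SL2 R => pi g) _
    (nbhs (big_cell (a, b, s) * g)%g)); last exact: coset_pi_continuous.
apply: SL2_mul_cvg; last exact: (@cvg_cst (SL2 R)).
have p11 : p.1.1 @[p --> (a, b, s)] --> a.
  by apply: (@cvg_comp _ _ _ fst fst _ (nbhs (a, b))); exact: cvg_fst.
have p12 : p.1.2 @[p --> (a, b, s)] --> b.
  by apply: (@cvg_comp _ _ _ fst snd _ (nbhs (a, b)));
    [exact: cvg_fst|exact: cvg_snd].
have p2 : p.2 @[p --> (a, b, s)] --> s by exact: cvg_snd.
have near0 : \forall p \near (a, b, s), p.1.1 != 0.
  exact: (p11 [set x | x != 0] (open_nbhs_nbhs (conj (@open_neq R 0) a0))).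
apply: cvg_SL2 => i j.
(* [sl2] tests the determinant, so continuity is proved for the explicit entries, which agree with
   it near the point. *)
pose E (p : R * R * R) := mx22 p.1.1 p.1.2 (- p.2 * p.1.1) (p.1.1^-1 - p.2 * p.1.2) i j.
have bE p : p.1.1 != 0 -> E p = SL2val (big_cell p) i j.
  move: p => [[a' b'] s']; rewrite /E [_.1.1]/= => a'0.
  rewrite big_cellE// -[SL2val _]/(val _) val_sl2//.
  exact: big_cell_det.
have nE : {near (a, b, s), E =1 (fun p => SL2val (big_cell p) i j)}.
  by move: near0; apply: (@filterS _ _ FF) => p /bE.
rewrite -bE//; apply: cvg_trans (near_eq_cvg nE) _.
rewrite /E mxE; under eq_fun do rewrite mxE.
case: ifP => _; case: ifP => _ //=.
- by apply: (@cvgM R _ _ FF (fun p => - p.2) (fun p => p.1.1)) => //; apply: (@cvgN R R^o).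
- apply: (@cvgB _ _ _ _ FF (fun p => p.1.1^-1) (fun p => p.2 * p.1.2)).
    exact: (@cvgV R _ _ FF (fun p => p.1.1)).
  exact: (@cvgM R _ _ FF (fun p => p.2) (fun p => p.1.2)).
Qed.

Definition cell_dom : set (R * R * R) := [set q | q.1.1 != 0].

Lemma open_cell_dom : open cell_dom.
Proof.
apply: (open_comp (f := fun q : R * R * R => q.1.1) (D := [set x | x != 0])).
  move=> q _; apply: (@cvg_comp _ _ _ fst fst _ (nbhs q.1)); exact: cvg_fst.
exact: open_neq.
Qed.

Lemma measurable_cell_dom : measurable cell_dom.
Proof. exact: open3_measurable open_cell_dom. Qed.

Lemma measurable_chart v : measurable_fun cell_dom (fun q => chart (q, v)).
Proof.
have mE : @measurable _ (coset_space H) = <<s @open (coset_space H) >> by [].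
apply: (measurability _ mE) => _ [U oU <-].
apply: open3_measurable; rewrite openE => q [q0 Uq].
apply: filterI.
  by apply: open_nbhs_nbhs; split => //; exact: open_cell_dom.
by apply: (@chart_cvg _ v q0); exact: open_nbhs_nbhs.
Qed.

Lemma compact_chart K v : (forall q, K q -> q.1.1 != 0) -> compact K ->
  compact ((fun q => chart (q, v)) @` K).
Proof.
move=> K0 cK; apply: continuous_compact cK; apply: continuous_in_subspaceT => q.
by move=> /set_mem/K0; exact: chart_cvg.
Qed.

Definition fund_sect x : (R * R * R) * Gamma_quo H := projT1 (cid (chart_surj x)).

Lemma fund_sectP x : fund_dom (fund_sect x).1 /\ chart (fund_sect x) = x.
Proof. exact: projT2 (cid (chart_surj x)). Qed.

Lemma fund_sectK (HZ : {subset H <= SL2Z}) y : fund_dom y.1 -> fund_sect (chart y) = y.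
Proof.
by move=> Dy; apply: chart_inj => //; have [] := fund_sectP (chart y).
Qed.

End chart.

(** * Compact exhaustion of the fundamental domain *)

Section fund_compact.
Variable R : realType.
Local Notation e n := (n.+1%:R^-1 : R).

(** Strict inequalities become closed ones with margin 1/(n+1), one piece for the Farey part and one
    for the cusp; the bounds on [s] are multiplied out so that only polynomials have to be
    continuous. *)
Definition fund_compact (n : nat) : set (R * R * R) :=
  ((`[e n, 1] `*` `[e n, 1]) `*` `[0, n%:R]) `&`
    ([set q | 1 + e n <= q.1.1 + q.1.2] `&` [set q | q.2 * (q.1.1 * q.1.2) <= 1 - e n])
  `|` ((`[1 + e n, n%:R] `*` `[0, 0]) `*` `[0, n%:R]) `&`
    [set q | q.2 * q.1.1 ^+ 2 <= 1 - e n].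

Lemma continuous3_1 : continuous (fun q : R * R * R => q.1.1).
Proof. by move=> q; apply: (@cvg_comp _ _ _ fst fst _ (nbhs q.1)); exact: cvg_fst. Qed.

Lemma continuous3_2 : continuous (fun q : R * R * R => q.1.2).
Proof.
by move=> q; apply: (@cvg_comp _ _ _ fst snd _ (nbhs q.1)); [exact: cvg_fst|exact: cvg_snd].
Qed.

Lemma continuous3_3 : continuous (fun q : R * R * R => q.2).
Proof. by move=> q; exact: cvg_snd. Qed.

Lemma closed3_le (f : R * R * R -> R) r : continuous f -> closed [set q | f q <= r].
Proof.
move=> cf; apply: (preimage_closed (f := f) (D := [set x | x <= r])).
  by move=> q _; exact: cf.
exact: closed_le.
Qed.

Lemma closed3_ge (f : R * R * R -> R) r : continuous f -> closed [set q | r <= f q].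
Proof.
move=> cf; apply: (preimage_closed (f := f) (D := [set x | r <= x])).
  by move=> q _; exact: cf.
exact: closed_ge.
Qed.

Lemma compact_fund_compact n : compact (fund_compact n).
Proof.
apply: compactU; apply: compact_closedI.
- by apply: compact_setX; [apply: compact_setX|]; exact: segment_compact.
- apply: closedI.
    apply: closed3_ge => q.
    exact: (@cvgD _ _ _ _ (nbhs_filter q) (fun q => q.1.1) (fun q => q.1.2) _ _
      (@continuous3_1 q) (@continuous3_2 q)).
  apply: closed3_le => q.
  apply: (@cvgM _ _ _ (nbhs_filter q) (fun q => q.2) (fun q => q.1.1 * q.1.2) _ _ (@continuous3_3 q)).
  exact: (@cvgM _ _ _ (nbhs_filter q) (fun q => q.1.1) (fun q => q.1.2) _ _
      (@continuous3_1 q) (@continuous3_2 q)).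
- by apply: compact_setX; [apply: compact_setX|]; exact: segment_compact.
- apply: closed3_le => q.
  apply: (@cvgM _ _ _ (nbhs_filter q) (fun q => q.2) (fun q => q.1.1 * q.1.1) _ _ (@continuous3_3 q)).
  exact: (@cvgM _ _ _ (nbhs_filter q) (fun q => q.1.1) (fun q => q.1.1) _ _
      (@continuous3_1 q) (@continuous3_1 q)).
Qed.

Lemma fund_compact_sub n : fund_compact n `<=` @fund_dom R.
Proof.
have n0 : 0 < e n by rewrite invr_gt0.
rewrite /fund_compact; move: (e n) n0 => d d0.
move=> [[a b] s] [] [[[/=]]]; rewrite !in_itv/=.
  move=> /andP[a0 a1] /andP[b0 b1] /andP[s0 s1] [ab sab]; left; split; first split => /=.
  - by rewrite a1 andbT (lt_le_trans d0).
  - by rewrite b1 andbT (lt_le_trans d0).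
  - by apply: lt_le_trans ab; rewrite ltrDl.
  rewrite /= s0 -[ltRHS]mul1r ltr_pdivlMr ?mulr_gt0 ?(lt_le_trans d0)//.
  by rewrite (le_lt_trans sab)// ltrBlDr ltrDl.
move=> /andP[a0 a1] /andP[b0 b1] /andP[s0 s1] sab; right; split => /=.
- by apply: lt_le_trans a0; rewrite ltrDl.
- by apply/eqP; rewrite eq_le b0 b1.
have a00 : 0 < a by apply: lt_le_trans a0; rewrite addr_gt0.
rewrite s0 -[ltRHS]mul1r ltr_pdivlMr ?exprn_gt0//.
by rewrite (le_lt_trans sab)// ltrBlDr ltrDl.
Qed.

Lemma exists_inv_le (r : R) : 0 < r -> exists N, forall n, (N <= n)%N -> e n <= r.
Proof.
move=> r0; exists (Num.bound r^-1) => n Nn.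
rewrite invf_ple ?posrE//; apply: le_trans (ltW (archi_boundP _)) _.
  by rewrite invr_ge0 ltW.
by rewrite ler_nat ltnW.
Qed.

Lemma exists_nat_ge (r : R) : exists N, forall n, (N <= n)%N -> r <= n%:R.
Proof.
exists (Num.bound `|r|) => n Nn.
apply: le_trans (ler_norm r) _; apply: le_trans (ltW (archi_boundP _)) _ => //.
by rewrite ler_nat.
Qed.

Lemma fund_dom_bigcup : @fund_dom R = \bigcup_n fund_compact n.
Proof.
apply/seteqP; split => [[[a b] s]|q [n _]]; last exact: fund_compact_sub.
case=> [[[/= /andP[a0 a1] /andP[b0 b1] ab] /andP[s0 s1]]|[/= a1 b0 /andP[s0 s1]]].
  have s1' : 0 < 1 - s * (a * b).
    by rewrite subr_gt0 -ltr_pdivlMr ?mulr_gt0// mul1r.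
  have ab' : 0 < a + b - 1 by rewrite subr_gt0.
  have [[[[N1 N1P] [N2 N2P]] [N3 N3P]] [N4 N4P]] := (exists_inv_le a0, exists_inv_le b0,
     exists_inv_le ab', exists_inv_le s1').
  have [N5 N5P] := exists_nat_ge s.
  have [n [/N1P h1 /N2P h2 /N3P h3 /N4P h4 /N5P h5]] : exists n,
      [/\ (N1 <= n)%N, (N2 <= n)%N, (N3 <= n)%N, (N4 <= n)%N & (N5 <= n)%N].
    by exists (N1 + N2 + N3 + N4 + N5)%N; split; clear; lia.
  exists n => //; left; split; first split; first split; rewrite /= ?in_itv/=.
  - by rewrite h1.
  - by rewrite h2.
  - by rewrite s0.
  - split; move: h3 h4 => /=; move: (e n) => d h3 h4.
      by rewrite -lerBrDl.
    by rewrite lerBrDr -lerBrDl.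
have a0 : 0 < a by exact: lt_trans a1.
have s1' : 0 < 1 - s * a ^+ 2.
  by rewrite subr_gt0 -ltr_pdivlMr ?exprn_gt0// mul1r.
have a1' : 0 < a - 1 by rewrite subr_gt0.
have [[[[N1 N1P] [N2 N2P]] [N3 N3P]] [N4 N4P]] := (exists_inv_le a1', exists_inv_le s1',
   exists_nat_ge a, exists_nat_ge s).
have [n [/N1P h1 /N2P h2 /N3P h3 /N4P h4]] : exists n,
    [/\ (N1 <= n)%N, (N2 <= n)%N, (N3 <= n)%N & (N4 <= n)%N].
  by exists (N1 + N2 + N3 + N4)%N; split; clear; lia.
exists n => //; right; split; first split; first split; rewrite /= ?in_itv/=.
- by rewrite h3 andbT -lerBrDl.
- by rewrite b0 lexx.
- by rewrite s0.
- by rewrite lerBrDr -lerBrDl.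
Qed.

End fund_compact.

(** * Borel measurability of the section *)

Section fund_sect_measurable.
Variables (R : realType) (H : groupClosed (SL2 R)).
Hypothesis HZ : {subset H <= SL2Z}.
Hypothesis Hfin : finite_set (Gamma_cosets H).
Implicit Types (g h : SL2 R) (x : coset_space H) (v : Gamma_quo H) (q : R * R * R).

Lemma finite_Gamma_quo : finite_set [set: Gamma_quo H].
Proof.
have -> : [set: Gamma_quo H] = (fun v => val v) @^-1` Gamma_cosets H.
  by apply/seteqP; split => v //= _; exact: set_mem (valP v).
by apply: finite_preimage => // v v' _ _; exact: val_inj.
Qed.

Definition fund_image (K : set (R * R * R)) v : set (coset_space H) :=
  (fun q => chart (q, v)) @` K.

Lemma closed_fund_image K v : K `<=` @fund_dom R -> compact K ->
  closed (fund_image K v).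
Proof.
move=> KD cK; apply: compact_closed; first exact: coset_space_hausdorff.
by apply: compact_chart => // q /KD/fund_dom_gt0 /lt0r_neq0.
Qed.

(** The source of measurability: for closed [P] the right-hand side is a countable union of
    continuous images of compact sets, and these are closed. *)
Lemma fund_sect_preimage (P : set (R * R * R)) v :
  [set x | P (fund_sect x).1 /\ (fund_sect x).2 = v] =
  \bigcup_n fund_image (fund_compact n `&` P) v.
Proof.
apply/seteqP; split => x /=.
  move=> [Px vx]; have [Dx cx] := fund_sectP x.
  move: Dx; rewrite fund_dom_bigcup => -[n _ Kx].
  by exists n => //; exists (fund_sect x).1 => //; rewrite -vx -surjective_pairing.
move=> [n _ [q [Kq Pq] <-]].
by rewrite fund_sectK//=; exact: fund_compact_sub Kq.
Qed.

Lemma measurable_fund_sect_preimage (P : set (R * R * R)) (V : set (Gamma_quo H)) :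
  closed P -> measurable [set x | P (fund_sect x).1 /\ V (fund_sect x).2].
Proof.
move=> cP.
rewrite (_ : [set x | _] = \bigcup_(v in V) [set x | P (fund_sect x).1 /\ (fund_sect x).2 = v]); last first.
  apply/seteqP; split => x /=; first by move=> [Px Vx]; exists (fund_sect x).2.
  by move=> [v Vv [Px vE]]; rewrite vE.
apply: fin_bigcup_measurable.
  by apply: sub_finite_set finite_Gamma_quo.
move=> v _; rewrite fund_sect_preimage; apply: bigcupT_measurable => n.
apply: closed_coset_measurable; apply: closed_fund_image.
  by apply: subset_trans (@fund_compact_sub R n) => q [].
exact: compact_closedI (@compact_fund_compact R n) cP.
Qed.

Lemma measurable_fund_sect : measurable_fun setT (@fund_sect R H).
Proof.
(* Closed rays generate the Borel sets of R, and their preimages under [f] are closed. *)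
have rays (f : R * R * R -> R) : continuous f ->
    measurable_fun setT (fun x : coset_space H => f (fund_sect x).1).
  move=> cf; apply: (measurability _ (measurable_realfun.RGenCInfty.measurableE R)).
  move=> _ [_ [r ->] <-]; rewrite setTI.
  rewrite (_ : _ @^-1` _ = [set x | [set q | r <= f q] (fund_sect x).1 /\
      [set: Gamma_quo H] (fund_sect x).2]).
    by apply: measurable_fund_sect_preimage; exact: closed3_ge.
  apply/seteqP; split => x /=; rewrite in_itv/= andbT; first by [].
  by case.
have -> : @fund_sect R H = fun x => (((fund_sect x).1.1.1, (fund_sect x).1.1.2,
    (fund_sect x).1.2), (fund_sect x).2).
  by apply/funext => x; case: (fund_sect x) => [[[]]].
apply: measurable_fun_pair.
  apply: measurable_fun_pair; first apply: measurable_fun_pair.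
  - exact: (rays (fun q => q.1.1) (@continuous3_1 R)).
  - exact: (rays (fun q => q.1.2) (@continuous3_2 R)).
  - exact: (rays (fun q => q.2) (@continuous3_3 R)).
move=> _ V _; rewrite setTI.
rewrite (_ : _ @^-1` _ = [set x | setT (fund_sect x).1 /\ V (fund_sect x).2]).
  by apply: measurable_fund_sect_preimage; exact: closedT.
by apply/seteqP; split => x //= [].
Qed.

Definition fund_exhaustion n : set (coset_space H) :=
  \bigcup_(v in [set: Gamma_quo H]) fund_image (fund_compact n) v.

Lemma compact_fund_exhaustion n : compact (fund_exhaustion n).
Proof.
rewrite /fund_exhaustion -bigsetU_fset_set; last exact: finite_Gamma_quo.
apply: bigsetU_compact => v _; apply: compact_chart; last exact: compact_fund_compact.
by move=> q /fund_compact_sub/fund_dom_gt0/lt0r_neq0.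
Qed.

Lemma measurable_fund_exhaustion n : measurable (fund_exhaustion n).
Proof.
apply: closed_coset_measurable; apply: compact_closed.
  exact: coset_space_hausdorff.
exact: compact_fund_exhaustion.
Qed.

Lemma bigcup_fund_exhaustion : \bigcup_n fund_exhaustion n = setT.
Proof.
apply/seteqP; split => // x _; have [Dx cx] := fund_sectP x.
move: Dx; rewrite fund_dom_bigcup => -[n _ Kx].
exists n => //; exists (fund_sect x).2 => //; by exists (fund_sect x).1.
Qed.

End fund_sect_measurable.

(** * Lebesgue measure and affine changes of variables *)

Definition pushforward_measure d d' (T1 : measurableType d) (T2 : measurableType d')
    (R : realType) (m : {measure set T1 -> \bar R}) (f : T1 -> T2)
    (mf : measurable_fun setT f) : {measure set T2 -> \bar R} :=
  measure_function_pushforward__canonical__measure_function_Measure m mf.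

Section lebesgue_real.
Variable R : realType.

Lemma measurable_idR : @measurable_fun _ _ (measurableTypeR R) R setT idfun.
Proof. by move=> _ A mA; rewrite setTI. Qed.

(* [lebesgue_measure] lives on [measurableTypeR R], whose display is not the one
   of the canonical measurable structure of [R] used for products. *)
Definition lebR : set R -> \bar R := pushforward_measure lebesgue_measure measurable_idR.

HB.instance Definition _ := Measure.on lebR.

Lemma sigma_finite_lebR : sigma_finite [set: R] lebR.
Proof. exact: sigma_finiteT lebesgue_measure. Qed.

HB.instance Definition _ := Measure_isSigmaFinite.Build _ _ _ lebR sigma_finite_lebR.

Lemma lebRE (A : set R) : lebR A = lebesgue_measure A.
Proof. by []. Qed.

Lemma ge0_integral_lebR (D : set R) (f : R -> \bar R) : measurable D ->
  measurable_fun D f -> (forall x, D x -> 0 <= f x)%E ->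
  (\int[lebR]_(x in D) f x = \int[lebesgue_measure]_(x in D) f x)%E.
Proof.
move=> mD mf f0.
apply: (ge0_integral_pushforward measurable_idR lebesgue_measure mD mf) => x.
by move=> /set_mem; exact: f0.
Qed.

Lemma lebR_unique (mu : {measure set R -> \bar R}) :
  (forall u v, mu `]u, v]%classic = lebR `]u, v]%classic) ->
  forall A, measurable A -> lebR A = mu A.
Proof.
move=> muE A mA.
have mid : @measurable_fun _ _ R (measurableTypeR R) setT idfun.
  by move=> _ B mB; rewrite setTI.
apply: (@lebesgue_measure_unique R (pushforward_measure mu mid)) => //.
by move=> _ [[u v] _ <-]; rewrite -lebRE -muE.
Qed.

Implicit Types (c d : R) (A : set R).

Lemma measurable_affine c d : measurable_fun setT (fun x : R => c * x + d).
Proof. by apply: measurable_funD => //; exact: measurable_funM. Qed.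

(** By uniqueness it is enough to compare on intervals ]u, v]; for [c < 0] the preimage is closed on
    the other side, with the same length. *)
Lemma lebR_preimage_affine c d A : c != 0 -> measurable A ->
  lebR [set x | A (c * x + d)] = ((`|c|^-1)%:E * lebR A)%E.
Proof.
move=> c0 mA.
have c00 : 0 < `|c| by rewrite normr_gt0.
pose m : {measure set R -> \bar R} :=
  mscale (NngNum (ltW c00)) (pushforward_measure lebR (measurable_affine c d)).
have -> : lebR A = m A; last first.
  rewrite /m /= /mscale /= muleA -EFinM mulVf ?mul1e//.
  by rewrite normr_eq0.
apply: (lebR_unique (mu := m)) => // u v.
rewrite /m /= /mscale /= /pushforward /=.
have [c_gt0|c_lt0] : 0 < c \/ c < 0 by move: c0; rewrite neq_lt => /orP[|]; [right|left].
  have -> : (fun x => c * x + d) @^-1` `]u, v] = `](u - d) / c, (v - d) / c]%classic.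
    apply/seteqP; split => x /=; rewrite !in_itv/= ltr_pdivrMr// ler_pdivlMr//;
    by rewrite ltrBlDr lerBrDr (mulrC x).
  rewrite !lebRE !lebesgue_measure_itv/= !lte_fin ltr_pdivrMr// divfK ?gt_eqF// ltrBlDr subrK.
  case: ifPn => uv; last by rewrite mule0.
  rewrite -!EFinB -EFinM; congr EFin.
  by rewrite gtr0_norm//; field.
have -> : (fun x => c * x + d) @^-1` `]u, v] = `[(v - d) / c, (u - d) / c[%classic.
  apply/seteqP; split => x /=; rewrite !in_itv/= ltr_ndivlMr// ler_ndivrMr//;
  by rewrite ltrBlDr lerBrDr (mulrC x) andbC.
rewrite !lebRE !lebesgue_measure_itv/= !lte_fin ltr_ndivlMr// divfK ?lt_eqF// ltrBlDr subrK.
case: ifPn => uv; last by rewrite mule0.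
rewrite -!EFinB -EFinM; congr EFin.
by rewrite ltr0_norm//; field.
Qed.

Lemma ge0_integral_affine c d (f : R -> \bar R) : c != 0 ->
  measurable_fun setT f -> (forall x, 0 <= f x)%E ->
  (\int[lebR]_x f (c * x + d)%R = (`|c|^-1)%:E * \int[lebR]_x f x)%E.
Proof.
move=> c0 mf f0.
have c00 : 0 <= `|c|^-1 by rewrite invr_ge0.
transitivity (\int[pushforward_measure lebR (measurable_affine c d)]_x f x)%E.
  have := ge0_integral_pushforward (measurable_affine c d) lebR measurableT mf (fun x _ => f0 x).
  by rewrite preimage_setT => <-.
rewrite (eq_measure_integral (mscale (NngNum c00) lebR)); last first.
  move=> A mA _; rewrite /pushforward /mscale/=.
  exact: (@lebR_preimage_affine c d A c0 mA).
by rewrite ge0_integral_mscale.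
Qed.

Lemma ge0_integral_shift d (f : R -> \bar R) :
  measurable_fun setT f -> (forall x, 0 <= f x)%E ->
  (\int[lebR]_x f (x + d)%R = \int[lebR]_x f x)%E.
Proof.
move=> mf f0; have := @ge0_integral_affine 1 d f (oner_neq0 _) mf f0.
by rewrite normr1 invr1 mul1e; under eq_integral do rewrite mul1r.
Qed.

Lemma lebR_preimage_shift d A : measurable A ->
  lebR [set x | A (x + d)] = lebR A.
Proof.
move=> mA; have := @lebR_preimage_affine 1 d A (oner_neq0 _) mA.
rewrite normr1 invr1 mul1e => <-; congr (lebR _).
by apply/seteqP; split => x /=; rewrite mul1r.
Qed.

End lebesgue_real.

Lemma product_sigma_finite d1 d2 (T1 : measurableType d1) (T2 : measurableType d2)
    (R : realType) (m1 : {sigma_finite_measure set T1 -> \bar R})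
    (m2 : {sigma_finite_measure set T2 -> \bar R}) : sigma_finite setT (m1 \x m2)%E.
Proof.
have /sigma_finiteP[F [TF ndF Foo]] := sigma_finiteT m1.
have /sigma_finiteP[G [TG ndG Goo]] := sigma_finiteT m2.
exists (fun n => F n `*` G n).
  apply/seteqP; split => // -[x y] _.
  have : setT x by []. have : setT y by []. rewrite TF TG => -[k _ Gy] [n _ Fx].
  exists (maxn n k) => //; split => /=.
    by have /subsetPset := ndF n (maxn n k) (leq_maxl _ _); apply.
  by have /subsetPset := ndG k (maxn n k) (leq_maxr _ _); apply.
move=> k; have [mF Fk] := Foo k; have [mG Gk] := Goo k.
split; first exact: measurableX.
by rewrite product_measure1E// lte_mul_pinfty// ge0_fin_numE.
Qed.

Section lebesgue3.
Variable R : realType.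
Local Open Scope ereal_scope.

Definition leb2 : set (R * R)%type -> \bar R := @lebR R \x @lebR R.
HB.instance Definition _ := Measure.on leb2.
HB.instance Definition _ := Measure_isSigmaFinite.Build _ _ _ leb2
  (product_sigma_finite (@lebR R) (@lebR R)).
Definition leb3 : set (R * R * R)%type -> \bar R := leb2 \x @lebR R.
HB.instance Definition _ := Measure.on leb3.
HB.instance Definition _ := Measure_isSigmaFinite.Build _ _ _ leb3
  (product_sigma_finite leb2 (@lebR R)).

Implicit Type S : set (R * R * R)%type.

Lemma leb2E (S : set (R * R)%type) : leb2 S = \int[@lebR R]_a lebR [set b | S (a, b)].
Proof.
rewrite /leb2 /= /product_measure1; apply: eq_integral => a _ /=; congr lebR.
by apply/seteqP; split => b; rewrite /xsection/= in_setE.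
Qed.

Lemma leb2E_swap (S : set (R * R)%type) : measurable S ->
  leb2 S = \int[@lebR R]_b lebR [set a | S (a, b)].
Proof.
move=> mS; transitivity ((@lebR R \x^ @lebR R) S).
  by apply: product_measure_unique => // *; exact: product_measure2E.
rewrite /product_measure2; apply: eq_integral => b _ /=; congr lebR.
by apply/seteqP; split => a; rewrite /ysection/= in_setE.
Qed.

Lemma measurable_leb_section S : measurable S ->
  measurable_fun setT (fun ab : (R * R)%type => lebR [set s | S (ab, s)]).
Proof.
move=> mS; have := @measurable_fun_xsection _ _ _ _ R (@lebR R) S mS.
congr (measurable_fun _ _); apply/funext => ab /=; congr lebR.
by apply/seteqP; split => s; rewrite /xsection/= in_setE.
Qed.

Lemma leb3_leb2 S : leb3 S = \int[leb2]_ab lebR [set s | S (ab, s)].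
Proof.
rewrite /leb3 /= [LHS]/product_measure1; apply: eq_integral => ab _ /=; congr lebR.
by apply/seteqP; split => s; rewrite /xsection/= in_setE.
Qed.

Lemma leb3E S : measurable S ->
  leb3 S = \int[@lebR R]_a \int[@lebR R]_b lebR [set s | S (a, b, s)].
Proof.
move=> mS; rewrite leb3_leb2 (fubini_tonelli1 (m1 := @lebR R) (m2 := @lebR R))//.
exact: measurable_leb_section.
Qed.

Lemma leb3E_swap S : measurable S ->
  leb3 S = \int[@lebR R]_b \int[@lebR R]_a lebR [set s | S (a, b, s)].
Proof.
move=> mS; rewrite (leb3E mS).
have f0 (ab : (R * R)%type) : 0 <= lebR [set s | S (ab, s)] by [].
exact: (@fubini_tonelli _ _ _ _ R (@lebR R) (@lebR R) _ (measurable_leb_section mS) f0).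
Qed.

Lemma measurable_slice1 S a : measurable S -> measurable [set bs : (R * R)%type | S (a, bs.1, bs.2)].
Proof.
move=> mS; rewrite -[X in measurable X]setTI.
have /(_ measurableT _ mS) : measurable_fun setT (fun bs : (R * R)%type => (a, bs.1, bs.2)).
  by apply: measurable_fun_pair => //; apply: measurable_fun_pair.
by [].
Qed.

Lemma leb3E_leb2 S : measurable S ->
  leb3 S = \int[@lebR R]_a leb2 [set bs | S (a, bs.1, bs.2)].
Proof.
by move=> mS; rewrite (leb3E mS); apply: eq_integral => a _; rewrite leb2E.
Qed.

End lebesgue3.

(** * Measurable structure of SL(2, R) *)

Section SL2_measurable.
Variable R : realType.
Implicit Types (g h : SL2 R) (a b c d s t : R).

Definition SL2_entries g : R * R * R * R :=
  (SL2val g 0 0, SL2val g 0 1, SL2val g 1 0, SL2val g 1 1).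

(** Pulled back from the entries and not generated by the topology, so that maps into G are checked
    entry by entry. *)
Definition SL2_measurable : set (set (SL2 R)) :=
  preimage_set_system setT SL2_entries measurable.

Let sa : sigma_algebra setT SL2_measurable.
Proof. by apply: sigma_algebra_preimage; exact: sigma_algebra_measurable. Qed.

Let SL2_measurable0 : SL2_measurable set0. Proof. by case: sa. Qed.

Let SL2_measurableC A : SL2_measurable A -> SL2_measurable (~` A).
Proof. by case: sa => _ + _ => /[apply]; rewrite setTD. Qed.

Let SL2_measurableU (F : (set (SL2 R))^nat) :
  (forall i, SL2_measurable (F i)) -> SL2_measurable (\bigcup_i F i).
Proof. by case: sa => _ _; apply. Qed.

HB.instance Definition _ := @isMeasurable.Build default_measure_display
  (SL2 R) SL2_measurable SL2_measurable0 SL2_measurableC SL2_measurableU.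

Lemma measurable_SL2_entry i j : measurable_fun setT (fun g : SL2 R => SL2val g i j).
Proof.
have me : measurable_fun setT SL2_entries by move=> _ A mA; exists A.
have [-> | ->] := ord2_01 i; have [-> | ->] := ord2_01 j.
- exact: (measurableT_comp measurable_fst (measurableT_comp measurable_fst
    (measurableT_comp measurable_fst me))).
- exact: (measurableT_comp measurable_snd (measurableT_comp measurable_fst
    (measurableT_comp measurable_fst me))).
- exact: (measurableT_comp measurable_snd (measurableT_comp measurable_fst me)).
- exact: (measurableT_comp measurable_snd me).
Qed.

Section measurable_fun_SL2.
Context disp (T : measurableType disp).

Lemma measurable_fun_SL2 (f : T -> SL2 R) :
  (forall i j, measurable_fun setT (fun x => SL2val (f x) i j)) ->
  measurable_fun setT f.
Proof.
move=> mf mT A [B mB <-]; rewrite !setTI.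
have mfB : measurable_fun setT (SL2_entries \o f).
  by apply: measurable_fun_pair; [apply: measurable_fun_pair; [apply: measurable_fun_pair|]|].
by have := mfB mT B mB; rewrite setTI.
Qed.

Lemma measurable_fun_SL2_entry (f : T -> SL2 R) i j : measurable_fun setT f ->
  measurable_fun setT (fun x => SL2val (f x) i j).
Proof. by move=> mf; exact: (measurableT_comp (measurable_SL2_entry i j) mf). Qed.

Lemma measurable_fun_SL2_mul (f h : T -> SL2 R) : measurable_fun setT f -> measurable_fun setT h ->
  measurable_fun setT (fun x => f x * h x)%g.
Proof.
move=> mf mh; apply: measurable_fun_SL2 => i j.
under eq_fun do rewrite SL2_mulE.
by apply: measurable_funD; apply: measurable_funM; exact: measurable_fun_SL2_entry.
Qed.

Lemma measurable_fun_SL2_inv (f : T -> SL2 R) : measurable_fun setT f ->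
  measurable_fun setT (fun x => (f x)^-1)%g.
Proof.
move=> mf; apply: measurable_fun_SL2 => i j.
under eq_fun do rewrite SL2_invE.
have D g : SL2val g 1 1 * SL2val g 0 0 - (- SL2val g 0 1) * (- SL2val g 1 0) = 1.
  by rewrite -(SL2_detE g); ring.
have [-> | ->] := ord2_01 i; have [-> | ->] := ord2_01 j.
- by under eq_fun do rewrite sl2E//; exact: measurable_fun_SL2_entry.
- by under eq_fun do rewrite sl2E//; apply: measurableT_comp => //; exact: measurable_fun_SL2_entry.
- by under eq_fun do rewrite sl2E//; apply: measurableT_comp => //; exact: measurable_fun_SL2_entry.
- by under eq_fun do rewrite sl2E//; exact: measurable_fun_SL2_entry.
Qed.

End measurable_fun_SL2.

End SL2_measurable.

(** * Haar measure of SL2 *)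

Section haar_SL2.
Variable R : realType.
Implicit Types (g h : SL2 R) (a b c d s t : R) (A : set (SL2 R)).
Local Notation cell_dom := (@cell_dom R).

Lemma big_cell_upper t a b s : a != 0 ->
  (big_cell (a, b, s) * sl2 1 t 0 1)%g = big_cell (a, b + t * a, s).
Proof.
move=> a0; have e : a * 1 + b * 0 = a by ring.
rewrite big_cellM ?e//; last by ring.
by congr (big_cell (_, _, _)); ring.
Qed.

Lemma big_cell_lower t a b s : a != 0 -> a + t * b != 0 ->
  (big_cell (a, b, s) * sl2 1 0 t 1)%g =
  big_cell (a + t * b, b, s - t / (a * (a + t * b))).
Proof.
move=> a0 ab; have e : a * 1 + b * t = a + t * b by ring.
rewrite big_cellM ?e//; last by ring.
by congr (big_cell (_, _, _)); ring.
Qed.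

Lemma measurable_invr : measurable_fun setT (fun x : R => x^-1).
Proof.
rewrite -(setvU [set 0]); apply/measurable_funU => //; first exact: measurableC.
split; last exact: measurable_fun_set1.
have -> : ~` [set 0] = [set x : R | x != 0] by apply/seteqP; split => x /= /eqP.
apply: open_continuous_measurable_fun; first exact: open_neq.
by move=> x /set_mem; exact: inv_continuous.
Qed.

Lemma measurable_coord1 : measurable_fun setT (fun q : R * R * R => q.1.1).
Proof. exact: (measurableT_comp measurable_fst measurable_fst). Qed.

Lemma measurable_coord2 : measurable_fun setT (fun q : R * R * R => q.1.2).
Proof. exact: (measurableT_comp measurable_snd measurable_fst). Qed.

Lemma measurable_cell_preimage A : measurable A ->
  measurable (cell_dom `&` (@big_cell R) @^-1` A).
Proof.
move=> [B mB <-]; rewrite setTI.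
pose phi (q : R * R * R) := (q.1.1, q.1.2, - q.2 * q.1.1, q.1.1^-1 - q.2 * q.1.2).
rewrite (_ : _ `&` _ = cell_dom `&` phi @^-1` B).
  apply: measurableI; first exact: measurable_cell_dom.
  rewrite -[X in measurable X]setTI.
  have m1 := measurable_coord1; have m2 := measurable_coord2.
  have mphi : measurable_fun setT phi.
    apply: measurable_fun_pair; [apply: measurable_fun_pair; [exact: measurable_fun_pair|]|].
      by apply: measurable_funM => //; exact: measurableT_comp.
    apply: measurable_funB; last exact: measurable_funM.
    exact: (measurableT_comp measurable_invr m1).
  exact: mphi.
apply/seteqP; split => -[[a b] s] [/= a0 Bq]; split => //; move: Bq;
  by rewrite /SL2_entries big_cellE// !sl2E ?big_cell_det.
Qed.

(* Haar measure of G in big cell coordinates; the elements with a = 0 are null. *)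
Definition haar_SL2 A : \bar R := leb3 (cell_dom `&` (@big_cell R) @^-1` A).

Let slice A a b : set R := [set s | (cell_dom `&` (@big_cell R) @^-1` A) (a, b, s)].

Let measurable_slice A : measurable A ->
  measurable_fun setT (fun ab : R * R => lebR (slice A ab.1 ab.2)).
Proof.
move=> mA; have -> : (fun ab : R * R => lebR (slice A ab.1 ab.2)) =
    (fun ab : R * R => lebR [set s | (cell_dom `&` (@big_cell R) @^-1` A) (ab, s)]).
  by apply/funext => -[].
exact: measurable_leb_section (measurable_cell_preimage mA).
Qed.

Let measurable_slice_b A a : measurable A ->
  measurable_fun setT (fun b : R => lebR (slice A a b)).
Proof. by move=> mA; exact: (measurableT_comp (measurable_slice mA) (pair1_measurable a)). Qed.

Let measurable_slice_a A b : measurable A ->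
  measurable_fun setT (fun a : R => lebR (slice A a b)).
Proof. by move=> mA; exact: (measurableT_comp (measurable_slice mA) (pair2_measurable b)). Qed.

Let measurable_slice_set A a b : measurable A -> measurable (slice A a b).
Proof.
move=> mA; rewrite -[X in measurable X]setTI.
have /(_ measurableT _ (measurable_cell_preimage mA)) :
    measurable_fun setT (fun s : R => (a, b, s)) by exact: measurable_fun_pair.
by [].
Qed.

Lemma measurable_mulr g A : measurable A -> measurable [set y | A (y * g)%g].
Proof.
move=> mA; rewrite -[X in measurable X]setTI.
have /(_ measurableT _ mA) : measurable_fun setT (fun y : SL2 R => y * g)%g.
  exact: (@measurable_fun_SL2_mul _ _ _ id (fun=> g)).
by [].
Qed.

Let right_invariant g := forall A, measurable A ->
  haar_SL2 [set y | A (y * g)%g] = haar_SL2 A.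

Let right_invariantM g h : right_invariant g -> right_invariant h ->
  right_invariant (g * h)%g.
Proof.
move=> gI hI A mA; rewrite -(hI A mA) -(gI _ (measurable_mulr h mA)).
by congr haar_SL2; apply/seteqP; split => y /=; rewrite mulgA.
Qed.

(** For fixed [a] and [s] the action is the translation of [b] by [t a]. *)
Let right_invariant_upper t : right_invariant (sl2 1 t 0 1).
Proof.
move=> A mA; rewrite /haar_SL2.
rewrite (leb3E (measurable_cell_preimage mA)).
rewrite (leb3E (measurable_cell_preimage (measurable_mulr _ mA))).
apply: eq_integral => a _.
have f0 (b : R) : (0 <= lebR (slice A a b))%E by [].
apply: (etrans _ (@ge0_integral_shift R (t * a) _ (measurable_slice_b a mA) f0)).
apply: eq_integral => b _; congr lebR; apply/seteqP; split => s [a0 sA]; split => //.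
  by move: sA; rewrite /= big_cell_upper.
by rewrite /= big_cell_upper.
Qed.

(** For fixed [b], the coordinate [a] is translated by [t b] and [s] by a function of [(a, b)], so
    [s] is integrated first. The values 0 and [- t b] of [a], at which one of the two matrices
    leaves the big cell, form a null set. *)
Let right_invariant_lower t : right_invariant (sl2 1 0 t 1).
Proof.
move=> A mA; rewrite /haar_SL2.
have mB := measurable_mulr (sl2 1 0 t 1) mA; set B := [set y | _] in mB *.
rewrite (leb3E_swap (measurable_cell_preimage mA)) (leb3E_swap (measurable_cell_preimage mB)).
apply: eq_integral => b _.
have f0 (a : R) : (0 <= lebR (slice A a b))%E by [].
apply: (etrans _ (@ge0_integral_shift R (t * b) _ (measurable_slice_a b mA) f0)).
apply: (ge0_ae_eq_integral measurableT (measurable_slice_a b mB)) => //.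
  have mshift : measurable_fun setT (fun a : R => a + t * b).
    by apply: measurable_funD.
  exact: (measurableT_comp (measurable_slice_a b mA) mshift).
exists [set 0; - (t * b)]; split; first by apply: measurableU.
  apply: (@countable_lebesgue_measure0 R [set 0; - (t * b)]).
  by apply: finite_set_countable; exact: finite_set2.
move=> a /= /not_implyP[_] sE; apply: contrapT => /not_orP[/eqP a0 /eqP ab].
have {}ab : a + t * b != 0 by apply: contra ab; rewrite addr_eq0.
apply: sE; rewrite -(lebR_preimage_shift (- (t / (a * (a + t * b)))) (measurable_slice_set _ _ mA)).
congr lebR; apply/seteqP; split => s [a0' sA]; split => //=; move: sA;
  by rewrite /B /= big_cell_lower.
Qed.

(** Unipotents generate G: a matrix with lower left entry [c != 0] is a product upper, lower, upper
    with middle parameter [c], and a lower unipotent moves the remaining matrices into that case. *)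
Lemma haar_SL2_mulr g A : measurable A ->
  haar_SL2 [set y | A (y * g)%g] = haar_SL2 A.
Proof.
move: A; rewrite -/(right_invariant g).
have inv10 h : SL2val h 1 0 != 0 -> right_invariant h.
  move=> h0; set a := SL2val h 0 0; set c := SL2val h 1 0; set d := SL2val h 1 1.
  have -> : h = (sl2 1 ((a - 1) / c) 0 1 * sl2 1 0 c 1 * sl2 1 ((d - 1) / c) 0 1)%g.
    have D := SL2_detE h; rewrite -/a -/c -/d in D.
    have bE : SL2val h 0 1 = (a * d - 1) / c.
      by apply: (mulIf h0); rewrite -/c divfK// -D; ring.
    apply: SL2_eq; rewrite !SL2_mulE !sl2E ?bE -/a -/c -/d; try ring; by field.
  apply: right_invariantM; first apply: right_invariantM;
    [exact: right_invariant_upper|exact: right_invariant_lower|exact: right_invariant_upper].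
have [g0|] := eqVneq (SL2val g 1 0) 0; last exact: inv10.
have -> : g = (g * sl2 1 0 1 1 * sl2 1 0 (- 1) 1)%g.
  by apply: SL2_eq; rewrite !SL2_mulE !sl2E; ring.
apply: right_invariantM; last exact: right_invariant_lower.
apply: inv10; rewrite SL2_mulE !sl2E; try ring.
rewrite g0 mul0r mulr1 add0r; have := SL2_detE g; rewrite g0 mulr0 subr0.
by have [->|//] := eqVneq (SL2val g 1 1) 0; rewrite mulr0 => /esym/eqP; rewrite oner_eq0.
Qed.

(** Transposition reverses products; once it is known to preserve the measure, it converts right
    invariance into left invariance. *)
Definition SL2_tr g : SL2 R := sl2 (SL2val g 0 0) (SL2val g 1 0) (SL2val g 0 1) (SL2val g 1 1).

Lemma SL2_tr_det g : SL2val g 0 0 * SL2val g 1 1 - SL2val g 1 0 * SL2val g 0 1 = 1.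
Proof. by rewrite -(SL2_detE g); ring. Qed.

Lemma SL2_trE g i j : SL2val (SL2_tr g) i j = SL2val g j i.
Proof.
by have [-> | ->] := ord2_01 i; have [-> | ->] := ord2_01 j; rewrite sl2E//; exact: SL2_tr_det.
Qed.

Lemma SL2_trK : involutive SL2_tr.
Proof. by move=> g; apply: SL2_eq; rewrite !SL2_trE. Qed.

Lemma SL2_trM g h : SL2_tr (g * h)%g = (SL2_tr h * SL2_tr g)%g.
Proof. by apply: SL2_eq; rewrite SL2_trE !SL2_mulE !SL2_trE; ring. Qed.

Lemma measurable_SL2_tr A : measurable A -> measurable [set y | A (SL2_tr y)].
Proof.
move=> mA; rewrite -[X in measurable X]setTI.
have /(_ measurableT _ mA) : measurable_fun setT SL2_tr.
  apply: measurable_fun_SL2 => i j; under eq_fun do rewrite SL2_trE.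
  exact: measurable_SL2_entry.
by [].
Qed.

Lemma big_cell_tr a b s : a != 0 ->
  SL2_tr (big_cell (a, b, s)) = big_cell (a, - s * a, - b / a).
Proof.
move=> a0; apply: SL2_eq; rewrite SL2_trE !big_cellE// !sl2E ?big_cell_det//; by field.
Qed.

(** In coordinates this is [(a, b, s) -> (a, - s a, - b / a)]: for fixed [a], an exchange of [b] and
    [s] with scalings [- a] and [- 1/a], whose product is 1. *)
Lemma haar_SL2_tr A : measurable A -> haar_SL2 [set y | A (SL2_tr y)] = haar_SL2 A.
Proof.
move=> mA; rewrite /haar_SL2.
have mB := measurable_SL2_tr mA; set B := [set y | _] in mB *.
rewrite (leb3E_leb2 (measurable_cell_preimage mA)) (leb3E_leb2 (measurable_cell_preimage mB)).
apply: eq_integral => a _.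
set U := [set bs | (cell_dom `&` (@big_cell R) @^-1` A) _].
set V := [set bs | _].
have mU : measurable U by exact: measurable_slice1 (measurable_cell_preimage mA).
have [a0|a0] := eqVneq a 0.
  by congr leb2; apply/seteqP; split => -[b s] [/= a0']; rewrite /cell_dom/= a0 eqxx in a0'.
have VE : V = [set bs | U (- bs.2 * a, - bs.1 / a)].
  apply/seteqP; split => -[b s] [_ sA]; split => //=; move: sA;
  by rewrite /B /= big_cell_tr.
rewrite VE (leb2E_swap mU) leb2E.
have mUb (c : R) : measurable [set b | U (b, c)].
  rewrite -[X in measurable X]setTI.
  have /(_ measurableT _ mU) : measurable_fun setT (fun b : R => (b, c)) by exact: pair2_measurable.
  by [].
have mK : measurable_fun setT (fun c : R => lebR [set b | U (b, c)]).
  have -> : (fun c : R => lebR [set b | U (b, c)]) = @lebR R \o ysection U.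
    apply/funext => c /=; congr lebR.
    by apply/seteqP; split => b; rewrite /ysection/= in_setE.
  exact: measurable_fun_ysection.
have f0 (c : R) : (0 <= lebR [set b | U (b, c)])%E by [].
have a0' : - a != 0 by rewrite oppr_eq0.
have aV0 : - a^-1 != 0 by rewrite oppr_eq0 invr_eq0.
transitivity (\int[@lebR R]_b ((`|a|^-1)%:E * lebR [set c | U (c, (- a^-1 * b + 0)%R)]))%E.
  apply: eq_integral => b _.
  have := @lebR_preimage_affine R (- a) 0 _ a0' (mUb (- a^-1 * b + 0)); rewrite normrN => <-.
  have E s : (- s * a, - b / a) = (- a * s + 0, - a^-1 * b + 0) by congr pair; ring.
  by congr lebR; apply/seteqP; split => s /=; rewrite E.
rewrite ge0_integralZl//; last first.
  exact: (measurableT_comp mK (measurable_affine (- a^-1) 0)).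
rewrite (ge0_integral_affine 0 aV0 mK f0) muleA -EFinM normrN normfV invrK.
by rewrite mulVf ?mul1e// normr_eq0.
Qed.

Lemma haar_SL2_mull g A : measurable A ->
  haar_SL2 [set y | A (g * y)%g] = haar_SL2 A.
Proof.
move=> mA; rewrite -(haar_SL2_tr mA) -(haar_SL2_mulr (SL2_tr g) (measurable_SL2_tr mA)).
rewrite -(haar_SL2_tr (measurable_mulr _ (measurable_SL2_tr mA))).
by congr haar_SL2; apply/seteqP; split => y /=; rewrite SL2_trM !SL2_trK.
Qed.

(** In SL(2) the inverse is the transpose conjugated by the quarter turn [w]. *)
Lemma haar_SL2_inv A : measurable A -> haar_SL2 [set y | A y^-1%g] = haar_SL2 A.
Proof.
move=> mA; pose w : SL2 R := sl2 0 1 (- 1) 0.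
have mwA : measurable [set y | A (w * (y * w^-1))%g].
  rewrite -[X in measurable X]setTI.
  have /(_ measurableT _ mA) : measurable_fun setT (fun y : SL2 R => w * (y * w^-1))%g.
    apply: (@measurable_fun_SL2_mul _ _ _ (fun=> w)) => //.
    exact: (@measurable_fun_SL2_mul _ _ _ id (fun=> w^-1)%g).
  by [].
transitivity (haar_SL2 [set y | A (w * (SL2_tr y * w^-1))%g]).
  congr haar_SL2; apply/funext => y /=; congr A.
  apply: (mulIg w); rewrite -!mulgA mulVg mulg1.
  apply: (mulgI y); rewrite mulVKg.
  apply: SL2_eq; rewrite !SL2_mulE !SL2_trE !sl2E; try ring;
  by move: (SL2_detE y); lra.
rewrite (haar_SL2_tr mwA).
have mw : measurable [set y | A (w * y)%g].
  rewrite -[X in measurable X]setTI.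
  have /(_ measurableT _ mA) : measurable_fun setT (fun y : SL2 R => w * y)%g.
    exact: (@measurable_fun_SL2_mul _ _ _ (fun=> w) id).
  by [].
by rewrite (haar_SL2_mulr w^-1%g mw) (haar_SL2_mull w mA).
Qed.

End haar_SL2.

Lemma measurable_comp_fst d1 d2 d3 (T1 : measurableType d1) (T2 : measurableType d2)
    (T3 : measurableType d3) (f : T1 -> T3) : measurable_fun setT f ->
  measurable_fun setT (fun x : T1 * T2 => f x.1).
Proof. by move=> mf; exact: (measurableT_comp mf measurable_fst). Qed.

Lemma measurable_comp_snd d1 d2 d3 (T1 : measurableType d1) (T2 : measurableType d2)
    (T3 : measurableType d3) (f : T2 -> T3) : measurable_fun setT f ->
  measurable_fun setT (fun x : T1 * T2 => f x.2).
Proof. by move=> mf; exact: (measurableT_comp mf measurable_snd). Qed.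

Lemma measurable_fun_pair_snd d1 d2 d3 (T1 : measurableType d1) (T2 : measurableType d2)
    (T3 : measurableType d3) (f : T1 -> T3) : measurable_fun setT f ->
  measurable_fun setT (fun x : T1 * T2 => (f x.1, x.2)).
Proof. by move=> mf; apply: measurable_fun_pair => //; exact: measurable_comp_fst. Qed.

Lemma measurable_setX_snd d1 d2 (T1 : measurableType d1) (T2 : measurableType d2)
    (A : set T2) : measurable A -> measurable [set x : T1 * T2 | A x.2].
Proof.
move=> mA; rewrite (_ : [set _ | _] = setT `*` A); first exact: measurableX.
by apply/seteqP; split => x //= [].
Qed.

Lemma product_measureE d1 d2 (T1 : measurableType d1) (T2 : measurableType d2)
    (R : realType) (m1 : {sigma_finite_measure set T1 -> \bar R})
    (m2 : {sigma_finite_measure set T2 -> \bar R}) A : measurable A ->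
  (m1 \x m2)%E A = (m1 \x^ m2)%E A.
Proof.
by move=> mA; apply: product_measure_unique => // *; exact: product_measure2E.
Qed.

Section fund_measurable.
Variable R : realType.

Lemma measurable_fund_dom : measurable (@fund_dom R).
Proof.
rewrite fund_dom_bigcup; apply: bigcupT_measurable => n.
rewrite -[fund_compact n]setCK; apply: measurableC; apply: open3_measurable.
rewrite openC; apply: compact_closed (@compact_fund_compact R n).
exact: (@pseudoMetricNormedZModType_hausdorff R (R * R * R)%type).
Qed.

Lemma measurable_big_cell : measurable_fun setT (@big_cell R).
Proof.
rewrite -(setvU (@cell_dom R)); apply/measurable_funU => //.
- by apply: measurableC; exact: measurable_cell_dom.
- exact: measurable_cell_dom.
split; last by move=> _ A mA; exact: measurable_cell_preimage.
(* At [a = 0] the determinant test in [sl2] fails, [farey_mx] takes its default value 1, and only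
   [horo] is left. *)
apply: (@eq_measurable_fun _ _ _ _ _ (fun q => horo q.2)).
  move=> [[a b] s] /set_mem /= /negP; rewrite negbK => /eqP/= a0.
  rewrite /big_cell /=; suff -> : farey_mx (a, b) = 1%g by rewrite mulg1.
  rewrite /farey_mx /sl2 /insubd insubN// det_mx22/= a0 mul0r mulr0 subr0.
  by rewrite eq_sym oner_eq0.
apply: measurable_funTS; apply: measurable_fun_SL2 => i j.
have ms : measurable_fun setT (fun q : R * R * R => - q.2) by exact: measurableT_comp.
have [-> | ->] := ord2_01 i; have [-> | ->] := ord2_01 j.
- rewrite (_ : (fun q : R * R * R => _) = cst 1); first exact: measurable_cst.
  by apply/funext => q; rewrite sl2E ?horo_det.
- rewrite (_ : (fun q : R * R * R => _) = cst 0); first exact: measurable_cst.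
  by apply/funext => q; rewrite sl2E ?horo_det.
- rewrite (_ : (fun q : R * R * R => _) = (fun q => - q.2))//.
  by apply/funext => q; rewrite sl2E ?horo_det.
- rewrite (_ : (fun q : R * R * R => _) = cst 1); first exact: measurable_cst.
  by apply/funext => q; rewrite sl2E ?horo_det.
Qed.

Lemma measurable_cell_coord : measurable_fun setT (@cell_coord R).
Proof.
apply: measurable_fun_pair; first by apply: measurable_fun_pair; exact: measurable_SL2_entry.
apply: measurable_funM.
  by apply: measurableT_comp => //; exact: measurable_SL2_entry.
exact: (measurableT_comp (@measurable_invr R) (measurable_SL2_entry 0 0)).
Qed.

End fund_measurable.

(** * Uniqueness of the invariant measure *)

Section sect_SL2.
Variables (R : realType) (H : groupClosed (SL2 R)).
Hypothesis HZ : {subset H <= SL2Z}.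
Hypothesis Hfin : finite_set (Gamma_cosets H).
Implicit Types (g h y : SL2 R) (x z : coset_space H) (v : Gamma_quo H) (E : set (coset_space H)).
Local Notation pi := (\pi_(coset_space H)).

Definition Gamma_repr v : SL2 R := repr (val v).

Definition sect_SL2 x : SL2 R :=
  (big_cell (fund_sect x).1 * Gamma_repr (fund_sect x).2)%g.

Lemma pi_Gamma_repr q v : pi (big_cell q * Gamma_repr v)%g = chart (q, v).
Proof. by []. Qed.

Lemma pi_sect_SL2 x : pi (sect_SL2 x) = x.
Proof.
rewrite pi_Gamma_repr -surjective_pairing; exact: (fund_sectP x).2.
Qed.

Lemma measurable_sect_SL2 : measurable_fun setT sect_SL2.
Proof.
have mf := measurable_fund_sect HZ Hfin.
apply: measurable_fun_SL2_mul.
  exact: (measurableT_comp (@measurable_big_cell R) (measurableT_comp measurable_fst mf)).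
(* The sigma-algebra of [Gamma_quo] is discrete. *)
have mr : measurable_fun setT Gamma_repr by [].
exact: (measurableT_comp mr (measurableT_comp measurable_snd mf)).
Qed.

(** This is sigma(E), written as a condition on [g] instead of an image. *)
Definition sect_set E : set (SL2 R) := [set g | E (pi g) /\ sect_SL2 (pi g) = g].

Definition fund_slice E v : set (R * R * R) :=
  @fund_dom R `&` [set q | E (chart (q, v))].

Lemma measurable_fund_slice E v : measurable E -> measurable (fund_slice E v).
Proof.
move=> mE; rewrite (_ : fund_slice E v =
    @fund_dom R `&` (@cell_dom R `&` (fun q => chart (q, v)) @^-1` E)).
  apply: measurableI; first exact: measurable_fund_dom.
  exact: (measurable_chart v (@measurable_cell_dom R) mE).
apply/seteqP; split => q /=; last by move=> [Dq [_ Eq]].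
by move=> [Dq Eq]; split => //; split => //; rewrite /cell_dom/= lt0r_neq0// fund_dom_gt0.
Qed.

Lemma sect_setE E : sect_set E = \bigcup_(v in [set: Gamma_quo H])
  [set g | fund_slice E v (cell_coord (g * (Gamma_repr v)^-1)%g)].
Proof.
apply/seteqP; split => g /=.
  move=> [Eg sg]; have [Dx cx] := fund_sectP (pi g).
  have e : (g * (Gamma_repr (fund_sect (pi g)).2)^-1)%g = big_cell (fund_sect (pi g)).1.
    by rewrite -[X in (X * _)%g]sg /sect_SL2 mulgK.
  exists (fund_sect (pi g)).2 => //=; rewrite e {e sg}.
  have a0 := lt0r_neq0 (fund_dom_gt0 Dx).
  move: (fund_sect _) Dx cx a0 => [[[a b] s] v]; rewrite [_.1]/= [_.2]/= => Dx cx a0.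
  by rewrite big_cellK//; split => //; rewrite /= cx.
move=> [v _ [Dq Eq]].
(* Membership in [fund_dom] makes the first coordinate positive, so the matrix lies in the big cell
   and can be rebuilt from its coordinates. *)
have g0 : SL2val (g * (Gamma_repr v)^-1)%g 0 0 != 0.
  by have := fund_dom_gt0 Dq => /lt0r_neq0.
move: Eq => /=; set q := cell_coord _ in Dq * => Eq.
have gE : (big_cell q * Gamma_repr v)%g = g by rewrite cell_coordK// mulgVK.
have gpi : pi g = chart (q, v) by rewrite -pi_Gamma_repr gE.
by rewrite /sect_set /mkset /sect_SL2 gpi fund_sectK.
Qed.

Lemma measurable_sect_piece E v : measurable E ->
  measurable [set g | fund_slice E v (cell_coord (g * (Gamma_repr v)^-1)%g)].
Proof.
move=> mE.
have := @measurable_cell_coord R measurableT _ (measurable_fund_slice v mE).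
by rewrite setTI => /(measurable_mulr (Gamma_repr v)^-1%g).
Qed.

Lemma measurable_sect_set E : measurable E -> measurable (sect_set E).
Proof.
move=> mE; rewrite sect_setE; apply: fin_bigcup_measurable.
  exact: finite_Gamma_quo.
by move=> v _; exact: measurable_sect_piece.
Qed.

(** Right invariance absorbs the representative of [v]. *)
Lemma haar_SL2_slice E v : measurable E ->
  haar_SL2 [set g | fund_slice E v (cell_coord (g * (Gamma_repr v)^-1)%g)] =
  leb3 (fund_slice E v).
Proof.
move=> mE.
have mS : measurable [set g | fund_slice E v (cell_coord g)].
  have := @measurable_cell_coord R measurableT _ (measurable_fund_slice v mE).
  by rewrite setTI.
rewrite (haar_SL2_mulr _ mS) /haar_SL2; congr leb3.
apply/seteqP; split => -[[a b] s] /=.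
  by move=> [a0]; rewrite big_cellK.
by move=> [Dq Eq]; have a0 := lt0r_neq0 (fund_dom_gt0 Dq); rewrite /= big_cellK.
Qed.

(** This computes nu(E) sheet by sheet; the pieces are disjoint by [chart_inj]. *)
Lemma haar_sect_set E : measurable E ->
  haar_SL2 (sect_set E) = (\sum_(v \in [set: Gamma_quo H]) leb3 (fund_slice E v))%E.
Proof.
move=> mE; rewrite sect_setE /haar_SL2 preimage_bigcup setI_bigcupr measure_fin_bigcup.
- by apply: eq_fsbigr => v _; exact: haar_SL2_slice.
- exact: finite_Gamma_quo.
- move=> v v' _ _ [q [[q0 [Dq _]] [_ [Dq' _]]]]; move: Dq Dq' => /=.
  have rE w : (big_cell q * (Gamma_repr w)^-1 * Gamma_repr w)%g = big_cell q.
    by rewrite mulgVK.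
  set p := cell_coord _; set p' := cell_coord _ => Dp Dp'.
  have gp : SL2val (big_cell q * (Gamma_repr v)^-1)%g 0 0 != 0.
    by have := fund_dom_gt0 Dp => /lt0r_neq0.
  have gp' : SL2val (big_cell q * (Gamma_repr v')^-1)%g 0 0 != 0.
    by have := fund_dom_gt0 Dp' => /lt0r_neq0.
  have : chart (p, v) = chart (p', v').
    rewrite -!pi_Gamma_repr; congr (pi _).
    by rewrite /p /p' !cell_coordK// !rE.
  by move=> /(@chart_inj _ _ HZ (p, v) (p', v') Dp Dp')[].
- by move=> v _; apply: measurable_cell_preimage; exact: measurable_sect_piece.
Qed.

Section unfolding.
Variable mu : {sigma_finite_measure set (coset_space H) -> \bar R}.
Hypothesis mu_inv : invariant_measure mu.

(* The set [hits E], in the coordinates of y = [big_cell xq.2], is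
   {(x, y) | x in E, y sigma(x) in sigma(X)} for the section sigma = [sect_SL2]
   of G -> X = G/H. Slicing it along x uses the right invariance of [haar_SL2];
   slicing it along y and substituting z = y x, the invariance of mu. *)
Let hits E : set (coset_space H * (R * R * R)) :=
  [set xq | [/\ @cell_dom R xq.2, E xq.1 &
    sect_set setT (big_cell xq.2 * sect_SL2 xq.1)%g]].

(** [hits E] after the substitution z = y x, with sigma(x) recovered as y^-1 sigma(z). *)
Let hits' E : set (coset_space H * (R * R * R)) :=
  [set xq | @cell_dom R xq.2 /\
    sect_set E ((big_cell xq.2)^-1 * sect_SL2 xq.1)%g].

Let m_big_cell2 : measurable_fun setT
  (fun xq : coset_space H * (R * R * R) => big_cell xq.2).
Proof. exact: measurable_comp_snd (@measurable_big_cell R). Qed.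

Let m_sect1 : measurable_fun setT
  (fun xq : coset_space H * (R * R * R) => sect_SL2 xq.1).
Proof. exact: measurable_comp_fst measurable_sect_SL2. Qed.

Let m_cell_dom2 : measurable [set xq : coset_space H * (R * R * R) | @cell_dom R xq.2].
Proof. exact: measurable_setX_snd (@measurable_cell_dom R). Qed.

Let measurable_hits E : measurable E -> measurable (hits E).
Proof.
move=> mE; rewrite (_ : hits E = [set xq | @cell_dom R xq.2] `&` (E `*` setT `&`
    [set xq | sect_set setT (big_cell xq.2 * sect_SL2 xq.1)%g])).
  apply: measurableI => //; apply: measurableI; first exact: measurableX.
  rewrite -[X in measurable X]setTI.
  have := measurable_fun_SL2_mul m_big_cell2 m_sect1.
  by move=> /(_ measurableT _ (measurable_sect_set measurableT)).
apply/seteqP; split => xq /=; first by case.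
by move=> [? [[? _] ?]].
Qed.

Let measurable_hits' E : measurable E -> measurable (hits' E).
Proof.
move=> mE; apply: measurableI => //.
rewrite -[X in measurable X]setTI.
have := measurable_fun_SL2_mul (measurable_fun_SL2_inv m_big_cell2) m_sect1.
by move=> /(_ measurableT _ (measurable_sect_set mE)).
Qed.

(** An element y sigma(x) of sigma(X) lies over z = y x, so it equals sigma(z), and y^-1 sigma(z) =
    sigma(x); the argument can be reversed. *)
Lemma translate_hits y E :
  coset_act y @` [set x | E x /\ sect_set setT (y * sect_SL2 x)%g] =
  [set z | sect_set E (y^-1 * sect_SL2 z)%g].
Proof.
apply/seteqP; split => z.
  move=> [x [Ex [_ sx]] <-] /=.
  have xE : pi (y * sect_SL2 x)%g = coset_act y x.
    by rewrite -[in RHS](pi_sect_SL2 x) coset_actE.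
  rewrite -xE sx mulKg; split; by rewrite pi_sect_SL2.
move=> /= [Ez sz].
set g := (y^-1 * sect_SL2 z)%g in Ez sz.
have yg : (y * g)%g = sect_SL2 z by rewrite /g mulVKg.
exists (pi g); last by rewrite coset_actE yg pi_sect_SL2.
by split => //; rewrite sz yg; split => //; rewrite pi_sect_SL2.
Qed.

Lemma haar_section_identity E : measurable E ->
  (mu E * haar_SL2 (sect_set setT) = haar_SL2 (sect_set E) * mu setT)%E.
Proof.
move=> mE.
have mh := measurable_hits mE; have mh' := measurable_hits' mE.
transitivity ((mu \x @leb3 R)%E (hits E)).
  rewrite /product_measure1.
  rewrite (eq_integral (fun x => haar_SL2 (sect_set setT) * (\1_E x)%:E)%E); last first.
    move=> x _ /=; rewrite indicE; have [xE|xE] := boolP (x \in E).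
      rewrite mule1 -(haar_SL2_mulr (sect_SL2 x) (measurable_sect_set measurableT)).
      congr leb3; apply/seteqP; split => q; rewrite /xsection/= in_setE.
        by move=> [].
      by move=> [q0 sq]; split => //; exact: set_mem.
    rewrite mule0; rewrite (_ : xsection _ _ = set0) ?measure0//.
    apply/seteqP; split => q //; rewrite /xsection/= in_setE => -[_ /mem_set].
    by rewrite (negbTE xE).
  rewrite ge0_integralZl//; last exact: measurableT_comp.
  by rewrite integral_indic// setIT muleC.
transitivity ((mu \x @leb3 R)%E (hits' E)).
  rewrite (product_measureE mu (@leb3 R) mh) (product_measureE mu (@leb3 R) mh') /product_measure2.
  apply: eq_integral => q _ /=.
  have [q0|q0] := pselect (@cell_dom R q); last first.
    congr (mu _); apply/seteqP; split => x; rewrite /ysection/= !in_setE.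
      by move=> [].
    by move=> [].
  have -> : ysection (hits E) q =
      [set x | E x /\ sect_set setT (big_cell q * sect_SL2 x)%g].
    by apply/seteqP; split => x; rewrite /ysection/= in_setE; [case|move=> []].
  have -> : ysection (hits' E) q =
      [set z | sect_set E ((big_cell q)^-1 * sect_SL2 z)%g].
    by apply/seteqP; split => x; rewrite /ysection/= in_setE; [case|].
  rewrite -translate_hits mu_inv//.
  have := measurable_ysection q mh.
  congr measurable; apply/seteqP; split => x; rewrite /ysection/= in_setE.
    by case.
  by move=> [].
rewrite /product_measure1.
(* The slice over z consists of the y with y^-1 sigma(z) in sigma(E); inversion and left invariance
   give it the measure nu(E), whatever z is. *)
rewrite (eq_integral (fun=> haar_SL2 (sect_set E))); last first.
  move=> z _ /=.
  have mA := measurable_sect_set mE.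
  have mAV : measurable [set y | sect_set E y^-1%g].
    have := @measurable_fun_SL2_inv R _ _ id (@measurable_id _ _ setT) measurableT _ mA.
    by rewrite setTI.
  rewrite -(haar_SL2_inv mA) -(haar_SL2_mull (sect_SL2 z)^-1%g mAV).
  congr leb3; apply/seteqP; split => q; rewrite /xsection/= in_setE.
    by move=> [q0 sq]; split => //=; rewrite invgM invgK.
  by move=> [q0]; rewrite /= invgM invgK.
by rewrite integral_cst.
Qed.

End unfolding.

End sect_SL2.

(** * The Basel sum and the volume of the fundamental domain *)

Section basel.
Variable R : realType.
Implicit Types (x t : R) (m n k : nat).

Lemma sin_le_id x : 0 < x -> sin x <= x.
Proof.
move=> x0.
have cs : {within `[0, x], continuous sin}.
  by apply: continuous_subspaceT => y; exact: continuous_sin.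
have [c _] := @MVT_segment R sin cos 0 x (ltW x0) (fun y _ => is_derive_sin y) cs.
by rewrite sin0 !subr0 => ->; rewrite ler_piMl ?cos_le1 ?ltW.
Qed.

Lemma id_le_tan x : 0 < x < pi / 2 -> x <= tan x.
Proof.
move=> /andP[x0 x2].
have cos_gt0 y : y \in `[0, x] -> 0 < cos y.
  rewrite in_itv/= => /andP[y0 yx]; apply: cos_gt0_pihalf.
  rewrite (lt_le_trans _ y0) ?(le_lt_trans yx)//.
  by rewrite oppr_lt0 divr_gt0// pi_gt0.
have dtan y : y \in `[0, x] -> is_derive y 1 tan (cos y ^- 2).
  by move=> /cos_gt0 y0; apply: is_derive_tan; rewrite gt_eqF.
have dtan' y : y \in `]0, x[ -> is_derive y 1 tan (cos y ^- 2).
  by move=> y0; apply: dtan; exact: subset_itv_oo_cc y0.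
have ct : {within `[0, x], continuous tan}.
  by apply: derivable_within_continuous => y /dtan yd; exact: ex_derive.
have [c cx] := @MVT_segment R tan (fun y => cos y ^- 2) 0 x (ltW x0) dtan' ct.
rewrite tan0 !subr0 => ->; rewrite ler_peMl ?(ltW x0)//.
by rewrite invf_ge1 ?exprn_gt0 ?cos_gt0// expr_le1 ?cos_le1// ltW ?cos_gt0.
Qed.

(* Iterating this identity from x = pi / 2 gives [sum_csc2_odd_angle], and
   sin x <= x <= tan x puts x ^- 2 between csc^2 x - 1 and csc^2 x (Hofbauer). *)
Lemma csc2_double x : sin x != 0 ->
  sin x ^- 2 = 4^-1 * (sin (x / 2) ^- 2 + sin ((pi - x) / 2) ^- 2).
Proof.
have -> : (pi - x) / 2 = - (x / 2 - pi / 2) by field.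
rewrite sinN sinBpihalf opprK.
have -> : sin x = 2 * (sin (x / 2) * cos (x / 2)).
  have {1}-> : x = x / 2 + x / 2 by rewrite -splitr.
  by rewrite sinD; ring.
rewrite !mulf_eq0 !negb_or => /and3P[_ s0 c0].
have := cos2Dsin2 (x / 2); move: (sin _) (cos _) s0 c0 => s c s0 c0 cs.
have -> : 4^-1 * (s ^- 2 + c ^- 2) = 4^-1 * ((c ^+ 2 + s ^+ 2) / (s ^+ 2 * c ^+ 2)).
  by field; rewrite s0 c0.
by rewrite cs; field; rewrite s0 c0.
Qed.

(** The distinct angles reached from pi/2 by [m + 1] steps [x -> x / 2] or [x -> (pi - x) / 2]. *)
Definition odd_angle m k : R := k.*2.+1%:R * pi / (2 ^ m.+2)%:R.

Lemma odd_angle_bounds m k : (k < 2 ^ m)%N -> 0 < odd_angle m k < pi / 2.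
Proof.
move=> km; have m0 : 0 < (2 ^ m.+2)%:R :> R by rewrite ltr0n expn_gt0.
rewrite /odd_angle divr_gt0 ?mulr_gt0 ?pi_gt0//= ltr_pdivrMr// mulrC -mulrA ltr_pM2l ?pi_gt0//.
have -> : (2 ^ m.+2)%:R = 2 * (2 ^ m.+1)%:R :> R by rewrite expnS natrM.
rewrite mulKf// ltr_nat expnS; lia.
Qed.

Lemma sum_csc2_odd_angle m :
  \sum_(k < 2 ^ m) sin (odd_angle m k) ^- 2 = 2 * 4 ^+ m.
Proof.
elim: m => [|m ih].
  rewrite big_ord1 expr0 mulr1 /odd_angle /= mul1r.
  have := csc2_double (x := pi / 2); rewrite sin_pihalf => /(_ (oner_neq0 _)).
  have -> : (pi - pi / 2) / 2 = pi / (2 ^ 2)%:R :> R by rewrite natrX; field.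
  have -> : pi / 2 / 2 = pi / (2 ^ 2)%:R :> R by rewrite natrX; field.
  by rewrite expr1n invr1 => e; lra.
have E : (2 ^ m.+1 = 2 ^ m + 2 ^ m)%N by rewrite expnS mul2n addnn.
(* The second half is reversed so that the two angles coming from [t = odd_angle m k], of indices
   [k] and [2^(m+1) - 1 - k], are paired. *)
rewrite exprS mulrCA -ih mulr_sumr E big_split_ord/= [X in _ + X](reindex_inj rev_ord_inj)/=.
rewrite -big_split/=; apply: eq_bigr => k _.
have := odd_angle_bounds (ltn_ord k); set t := odd_angle m k => t0.
have m0 : (2 ^ m.+2)%:R != 0 :> R by rewrite pnatr_eq0 expn_eq0.
rewrite (csc2_double (x := t)); last by rewrite gt_eqF// sin_gt0_pihalf.
rewrite mulrA mulfV// mul1r; congr (sin _ ^- 2 + sin _ ^- 2).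
  by rewrite /t /odd_angle [(2 ^ m.+3)%N]expnS natrM; field.
rewrite /t /odd_angle [(2 ^ m.+3)%N]expnS natrM.
have -> : (2 ^ m + (2 ^ m - k.+1)).*2.+1%:R = (2 ^ m.+2)%:R - k.*2.+1%:R :> R.
  rewrite -natrB; last by have := ltn_ord k; rewrite !expnS; lia.
  by congr (_%:R); have := ltn_ord k; rewrite !expnS; lia.
by field.
Qed.

Definition odd_sum n : R := \sum_(k < n) k.*2.+1%:R ^- 2.

Lemma sum_odd_angle m : \sum_(k < 2 ^ m) odd_angle m k ^- 2 =
  16 * 4 ^+ m / pi ^+ 2 * odd_sum (2 ^ m).
Proof.
rewrite /odd_sum mulr_sumr; apply: eq_bigr => k _; rewrite /odd_angle.
have -> : (2 ^ m.+2)%:R = 4 * 2 ^+ m :> R by rewrite natrX !exprS; ring.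
have -> : 4 ^+ m = 2 ^+ m * 2 ^+ m :> R by rewrite -exprMn -natrM.
have p0 : pi != 0 :> R by rewrite gt_eqF// pi_gt0.
have m0 : 2 ^+ m != 0 :> R by rewrite expf_neq0.
have k0 : k.*2.+1%:R != 0 :> R by rewrite pnatr_eq0.
move: (pi : R) (2 ^+ m : R) (k.*2.+1%:R : R) p0 m0 k0 => p d n p0 d0 n0.
by field; rewrite p0 d0 n0.
Qed.

(** The error term comes from csc^2 - 1 in the lower bound: a defect of 1 for each of [2^m] angles,
    against a total of [2 * 4^m]. *)
Lemma odd_sum_bounds m :
  pi ^+ 2 / 8 - pi ^+ 2 / 16 * (1 / 2) ^+ m <= odd_sum (2 ^ m) <= pi ^+ 2 / 8.
Proof.
have p0 : 0 < pi ^+ 2 :> R by rewrite exprn_gt0 ?pi_gt0.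
have m0 : 0 < 2 ^+ m :> R by rewrite exprn_gt0.
have m4 : 4 ^+ m = 2 ^+ m * 2 ^+ m :> R by rewrite -exprMn -natrM.
have up : \sum_(k < 2 ^ m) odd_angle m k ^- 2 <= 2 * 4 ^+ m.
  rewrite -sum_csc2_odd_angle; apply: ler_sum => k _.
  have tb := odd_angle_bounds (ltn_ord k); have /andP[t0 _] := tb.
  have s0 := sin_gt0_pihalf tb.
  rewrite lef_pV2 ?posrE ?exprn_gt0//; apply: lerXn2r; rewrite ?nnegrE ?sin_le_id//;
  exact: ltW.
have lo : 2 * 4 ^+ m - 2 ^+ m <= \sum_(k < 2 ^ m) odd_angle m k ^- 2.
  rewrite lerBlDr -sum_csc2_odd_angle.
  have -> : 2 ^+ m = \sum_(k < 2 ^ m) 1 :> R by rewrite sumr_const card_ord natrX.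
  rewrite -big_split; apply: ler_sum => k _ /=.
  have tb := odd_angle_bounds (ltn_ord k); have /andP[t0 t1] := tb.
  have s0 := sin_gt0_pihalf tb.
  have c0 : 0 < cos (odd_angle m k).
    by apply: cos_gt0_pihalf; rewrite t1 andbT (lt_trans _ t0)// oppr_lt0 divr_gt0 ?pi_gt0.
  have := id_le_tan tb; rewrite /tan; move: (odd_angle m k) t0 s0 c0 (cos2Dsin2 (odd_angle m k)) => t.
  move: (sin t) (cos t) => s c t0 s0 c0 cs tsc.
  have -> : s ^- 2 = 1 + (s / c) ^- 2.
    rewrite -[LHS]mul1r -[X in X * _]cs; field; by rewrite !gt_eqF.
  rewrite [X in X <= _]addrC lerD2r lef_pV2 ?posrE ?exprn_gt0 ?divr_gt0//.
  by apply: lerXn2r; rewrite ?nnegrE// ltW// divr_gt0.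
rewrite sum_odd_angle m4 in up lo.
have e12 : (1 / 2) ^+ m = (2 ^+ m)^-1 :> R by rewrite expr_div_n expr1n div1r.
rewrite e12; move: (odd_sum _) (2 ^+ m : R) (pi ^+ 2 : R) m0 p0 up lo => O d P d0 P0 up lo.
apply/andP; split.
  rewrite -(ler_pM2l (x := 16 * (d * d) / P)) ?divr_gt0 ?mulr_gt0//.
  apply: le_trans lo; rewrite le_eqVlt; apply/orP; left; apply/eqP.
  by field; rewrite !gt_eqF.
rewrite -(ler_pM2l (x := 16 * (d * d) / P)) ?divr_gt0 ?mulr_gt0//.
apply: (le_trans up); rewrite le_eqVlt; apply/orP; left; apply/eqP.
by field; rewrite gt_eqF.
Qed.

Definition zeta2_sum n : R := \sum_(k < n) k.+1%:R ^- 2.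

Lemma zeta2_sum_double n : zeta2_sum n.*2 = odd_sum n + zeta2_sum n / 4.
Proof.
elim: n => [|n ih]; first by rewrite /zeta2_sum /odd_sum !big_ord0 mul0r addr0.
rewrite doubleS /zeta2_sum /odd_sum !big_ord_recr/= -/(zeta2_sum _) -/(zeta2_sum _) -/(odd_sum _).
rewrite ih; have -> : n.*2.+2%:R = 2 * n.+1%:R :> R by rewrite -natrM mul2n doubleS.
have a0 : n.*2.+1%:R != 0 :> R by rewrite pnatr_eq0.
have b0 : n.+1%:R != 0 :> R by rewrite pnatr_eq0.
move: (n.*2.+1%:R : R) (n.+1%:R : R) a0 b0 => a b a0 b0.
by field; rewrite a0 b0.
Qed.

Lemma zeta2_sum_homo : {homo zeta2_sum : n m / (n <= m)%N >-> n <= m}.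
Proof.
apply: homo_leq => [x|y x z xy yz|n]; [exact: lexx|exact: le_trans xy yz|].
by rewrite /zeta2_sum big_ord_recr/= lerDl invr_ge0 exprn_ge0.
Qed.

(** Along powers of 2, splitting by parity yields z = pi^2/8 + z/4 for the limit z, once z is known
    to exist. *)
Lemma cvg_zeta2_sum : zeta2_sum @ \oo --> pi ^+ 2 / 6.
Proof.
(* Any bound above pi^2/6, the fixed point of x -> pi^2/8 + x/4, survives doubling; the added 1
   covers the first term. *)
pose B : R := pi ^+ 2 / 6 + 1.
have p0 : 0 < pi ^+ 2 :> R by rewrite exprn_gt0 ?pi_gt0.
have zB m : zeta2_sum (2 ^ m) <= B.
  elim: m => [|m ih].
    rewrite /zeta2_sum big_ord1 expr1n invr1 /B lerDr; lra.
  rewrite expnS mul2n zeta2_sum_double.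
  have /andP[_ h] := odd_sum_bounds m; rewrite /B in ih *; lra.
have cz : cvgn zeta2_sum.
  apply: nondecreasing_is_cvgn; first exact: zeta2_sum_homo.
  exists B => _ [n _ <-]; apply: le_trans (zB n); apply: zeta2_sum_homo.
  exact/ltnW/ltn_expl.
have e2 : (2 ^ m)%N @[m --> \oo] --> \oo.
  move=> A [N _ NA]; exists N => // m /= Nm; apply: NA => /=.
  by apply: leq_trans Nm _; exact/ltnW/ltn_expl.
have z0 : zeta2_sum (2 ^ m) @[m --> \oo] --> limn zeta2_sum.
  exact: (@cvg_comp _ _ _ (fun m => 2 ^ m)%N zeta2_sum _ \oo _ e2 cz).
have z1 : zeta2_sum (2 ^ m.+1) @[m --> \oo] --> limn zeta2_sum.
  by have := z0; rewrite -(cvg_shiftn 1); under eq_fun do rewrite addn1.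
have o0 : odd_sum (2 ^ m) @[m --> \oo] --> pi ^+ 2 / 8.
  apply: (@squeeze_cvgr _ _ _ _ _ (cst (pi ^+ 2 / 8)) _ _ (pi ^+ 2 / 8)).
  - by apply: nearW => m; exact: odd_sum_bounds.
  - rewrite -[X in _ --> X]subr0; apply: cvgB; first exact: cvg_cst.
    rewrite -(mulr0 (pi ^+ 2 / 16)); apply: cvgM; first exact: cvg_cst.
    by apply: cvg_expr; rewrite ger0_norm; lra.
  - exact: cvg_cst.
have z2 : odd_sum (2 ^ m) + zeta2_sum (2 ^ m) / 4 @[m --> \oo] --> pi ^+ 2 / 8 + limn zeta2_sum / 4.
  by apply: cvgD => //; apply: cvgM => //; exact: cvg_cst.
have z12 : (fun m => zeta2_sum (2 ^ m.+1)) = (fun m => odd_sum (2 ^ m) + zeta2_sum (2 ^ m) / 4).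
  by apply/funext => m; rewrite expnS mul2n zeta2_sum_double.
rewrite z12 in z1.
have zE : limn zeta2_sum = pi ^+ 2 / 8 + limn zeta2_sum / 4.
  exact: (cvg_unique (@Rhausdorff R) z1 z2).
suff <- : limn zeta2_sum = pi ^+ 2 / 6 by [].
by move: zE; move: (limn zeta2_sum : R) (pi ^+ 2 : R) => z P zE; lra.
Qed.

End basel.

(** * Return times and return map *)

Section dynamics.
Variables (R : realType) (H : groupClosed (SL2 R)).
Hypothesis HZ : {subset H <= SL2Z}.
Implicit Types (g h y : SL2 R) (x z : coset_space H) (v : Gamma_quo H) (a b s t : R) (ab : R * R).
Local Notation pi := (\pi_(coset_space H)).

Lemma coset_actM g h x : coset_act g (coset_act h x) = coset_act (g * h)%g x.
Proof.
rewrite -[x]reprK (coset_actE H h) (coset_actE H g) (coset_actE H (g * h)%g).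
by rewrite mulgA.
Qed.

Lemma big_cell0 ab : big_cell (ab, 0) = farey_mx ab.
Proof. by rewrite /big_cell /= horo0; exact: mul1g. Qed.

Lemma horo_big_cell t ab s : (horo t * big_cell (ab, s))%g = big_cell (ab, s + t).
Proof.
by rewrite (addrC s) /big_cell /= -horoD; exact: mulgA.
Qed.

Lemma coset_act_horo t ab s v :
  coset_act (horo t) (chart (ab, s, v)) = chart (ab, s + t, v).
Proof. by rewrite /chart coset_actM horo_big_cell. Qed.

Lemma section_paramE ab v : section_param (ab, v) = chart (ab, 0, v).
Proof. by rewrite /section_param /chart /= big_cell0. Qed.

Lemma proj_chart ab v :
  coset_proj (chart (ab, 0, v)) = \pi_(coset_space SL2Z) (farey_mx ab).
Proof.
have [g gZ vg] := Gamma_quoP v; rewrite (chart_pi _ vg) big_cell0 coset_projE//.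
by apply/coset_eqP; rewrite invgM mulgVK gpredVr.
Qed.

Lemma lifted_sectionP x : lifted_section H x <->
  exists2 ab, farey_triangle ab & exists v, x = chart (ab, 0, v).
Proof.
split.
  move=> [_ [ab Oab <-] /coset_eqP gZ]; exists ab => //; exists (Gamma_pi H gZ).
  by rewrite (@chart_pi _ _ _ _ ((farey_mx ab)^-1 * repr x)%g)// big_cell0 mulVKg reprK.
move=> [ab Oab [v ->]]; rewrite /lifted_section /= proj_chart.
by exists (farey_mx ab) => //; exists ab.
Qed.

Lemma roof_chart ab v : farey_triangle ab ->
  roof (coset_proj (chart (ab, 0, v))) = (ab.1 * ab.2)^-1.
Proof. by move=> Oab; rewrite proj_chart roofE. Qed.

Lemma chart_returnE a b s v : farey_triangle (a, b) -> exists v',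
  chart (a, b, s, v) =
  chart (b, (Num.floor ((1 + a) / b))%:~R * b - a, s - (a * b)^-1, v').
Proof.
move=> Oab; have [a0 b0] := farey_gt0 Oab; have [g gZ vg] := Gamma_quoP v.
set k := Num.floor _.
have kgZ : (return_sl2 k%:~R * g)%g \in @SL2Z R by rewrite gpredM ?return_sl2Z.
exists (Gamma_pi H kgZ); rewrite (chart_pi _ vg) (@chart_pi _ _ _ _ (return_sl2 k%:~R * g)%g)//.
by rewrite (@big_cell_return R k%:~R) ?gt_eqF// -mulgA.
Qed.

Lemma fund_main0 ab : farey_triangle ab -> @fund_main R (ab, 0).
Proof.
case: ab => a b Oab; have [a0 b0] := farey_gt0 Oab.
by split => //=; rewrite lexx invr_gt0 mulr_gt0.
Qed.

(** At time 1/(ab) the return identity leads to a point with [s = 0] over the triangle. An earlier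
    hit would give one point two coordinates in the strict domain, with third entries [t > 0] and
    0. *)
Lemma first_return_roof x : lifted_section H x ->
  first_return (lifted_section H) x (roof (coset_proj x)).
Proof.
move=> /lifted_sectionP[[a b] Oab [v ->]]; rewrite roof_chart//=.
have [a0 b0] := farey_gt0 Oab.
have ab0 : 0 < (a * b)^-1 by rewrite invr_gt0 mulr_gt0.
split; first split => //.
  rewrite /hit_times/= coset_act_horo add0r.
  have [v' ->] := chart_returnE (a * b)^-1 v Oab; rewrite subrr.
  by apply/lifted_sectionP; exists (b, (Num.floor ((1 + a) / b))%:~R * b - a);
    [exact: farey_return|exists v'].
move=> t [t0]; rewrite /hit_times/= coset_act_horo add0r => /lifted_sectionP.
move=> [ab' Oab' [v']] e; rewrite leNgt; apply/negP => tab.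
have D : fund_dom (a, b, t) by left; split => //=; rewrite tab ltW.
have D' : fund_dom (ab', 0) by left; exact: fund_main0.
have /(_ D D' e)[_ t00 _] := @chart_inj R H HZ (a, b, t, v) (ab', 0, v').
by rewrite t00 ltxx in t0.
Qed.

(** Return times are 1/(ab) >= 1; this uniform gap yields both countability and discreteness. *)
Lemma hit_times_spaced x s t : hit_times (lifted_section H) x s ->
  hit_times (lifted_section H) x t -> s < t -> 1 <= t - s.
Proof.
rewrite /hit_times/= => Ss St st.
have [_ /(_ (t - s))] := first_return_roof Ss.
rewrite /mkset subr_gt0 /hit_times/= coset_actM horoD subrK => /(_ (conj st St)).
apply: le_trans; move/lifted_sectionP : Ss => [[a b] Oab [v ->]].
by rewrite roof_chart//=; exact: farey_roof_ge1.
Qed.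

Lemma countable_hit_times x : countable (hit_times (lifted_section H) x).
Proof.
set S := hit_times _ x.
(* Hitting times with equal floors would be less than 1 apart. *)
have finj : {in S &, injective (fun s : R => Num.floor s)}.
  move=> s t /set_mem Ss /set_mem St fst.
  have [st|ts|//] := ltgtP s t; exfalso.
    have := hit_times_spaced Ss St st; have := floor_le s; have := floorD1_gt t.
    by rewrite fst intrD; lra.
  have := hit_times_spaced St Ss ts; have := floor_le t; have := floorD1_gt s.
  by rewrite fst intrD; lra.
apply/countable_injP; exists (fun s => choice.pickle (Num.floor s)) => s t Ss St.
by move=> /(pcan_inj (@choice.pickleK int)); exact: finj.
Qed.

Lemma isolated_hit_times x :
  hit_times (lifted_section H) x `<=` isolated (hit_times (lifted_section H) x).
Proof.
move=> s Ss; split; first exact: mem_set.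
exists (ball s 1); first exact: nbhsx_ballx.
apply/seteqP; split => [t [st St]|_ ->]; last by split => //; exact: ballxx.
move: st; rewrite /ball/= => st; have [ts|st'|//] := ltgtP t s; exfalso.
  have := hit_times_spaced St Ss ts; move: st; rewrite gtr0_norm; lra.
have := hit_times_spaced Ss St st'; move: st; rewrite ltr0_norm; lra.
Qed.

Lemma suspension_chart x s : suspension H (x, s) -> exists ab v,
  [/\ x = chart (ab, 0, v), farey_triangle ab & @fund_main R (ab, s)].
Proof.
move=> [/= /lifted_sectionP[ab Oab [v ->]]]; rewrite roof_chart// => s01.
by exists ab, v.
Qed.

Lemma suspension_flow_chart ab v s :
  suspension_flow (chart (ab, 0, v), s) = chart (ab, s, v).
Proof. by rewrite /suspension_flow /= coset_act_horo add0r. Qed.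

Lemma suspension_flow_inj : set_inj (suspension H) suspension_flow.
Proof.
move=> [x s] [x' s'] /set_mem/suspension_chart[ab [v [-> Oab Ds]]].
move=> /set_mem/suspension_chart[ab' [v' [-> Oab' Ds']]].
rewrite !suspension_flow_chart => e.
have /(_ (or_introl Ds) (or_introl Ds') e)[-> -> ->] //:= @chart_inj R H HZ (ab, s, v) (ab', s', v').
Qed.

(** The flow from the section thus misses exactly the points whose coordinates lie in
    [fund_cusp]. *)
Lemma suspension_image : suspension_flow @` suspension H =
  [set x | @fund_main R (fund_sect x).1].
Proof.
apply/seteqP; split => x /=.
  move=> [[y s] /suspension_chart[ab [v [-> Oab Ds]]] <-].
  by rewrite suspension_flow_chart fund_sectK//; left.
move=> Dx; have [_ cx] := fund_sectP x.
move: (fund_sect x) Dx cx => [[ab s] v] /= Dx cx.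
have [Oab s01] := Dx; exists (chart (ab, 0, v), s).
  split => /=; last by rewrite roof_chart.
  by apply/lifted_sectionP; exists ab => //; exists v.
by rewrite suspension_flow_chart.
Qed.

Lemma hit_times_suspension x : (suspension_flow @` suspension H) x ->
  hit_times (lifted_section H) x !=set0.
Proof.
move=> [[y s] /suspension_chart[ab [v [-> Oab _]]] <-]; exists (- s).
rewrite /hit_times/= suspension_flow_chart coset_act_horo subrr.
by apply/lifted_sectionP; exists ab => //; exists v.
Qed.

Lemma lifted_sectionE : lifted_section H =
  [set pi (p * g)%g | p in farey_mxs & g in [set g | g \in SL2Z]].
Proof.
apply/seteqP; split => x.
  move=> /lifted_sectionP[ab Oab [v ->]]; have [g gZ vg] := Gamma_quoP v.
  exists (farey_mx ab); first by exists ab.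
  by exists g => //; rewrite (chart_pi _ vg) big_cell0.
move=> [_ [ab Oab <-] [g gZ <-]]; apply/lifted_sectionP; exists ab => //.
by exists (Gamma_pi H gZ); rewrite (@chart_pi _ _ _ _ g)// big_cell0.
Qed.

Lemma section_param_bij :
  set_bij (farey_triangle `*` [set: Gamma_quo H]) (lifted_section H) section_param.
Proof.
split.
- move=> [ab v] [Oab _]; rewrite section_paramE; apply/lifted_sectionP.
  by exists ab => //; exists v.
- move=> [ab v] [ab' v'] /set_mem[/= /fund_main0 Dab _] /set_mem[/= /fund_main0 Dab' _].
  rewrite !section_paramE => e.
  by have /(_ (or_introl Dab) (or_introl Dab') e)[-> ->] :=
    @chart_inj R H HZ (ab, 0, v) (ab', 0, v').
- move=> x /lifted_sectionP[ab Oab [v ->]]; exists (ab, v) => //.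
  by rewrite section_paramE.
Qed.

Definition return_map x := coset_act (horo (roof (coset_proj x))) x.

Lemma return_map_farey a b g : farey_triangle (a, b) -> g \in SL2Z ->
  let k := (Num.floor ((1 + a) / b))%:~R in
  return_map (pi (farey_mx (a, b) * g)%g) =
  pi (sl2 b (k * b - a) 0 b^-1 * (sl2 k 1 (- 1) 0 * g))%g.
Proof.
move=> Oab gZ k; have [a0 b0] := farey_gt0 Oab.
have xE : pi (farey_mx (a, b) * g)%g = chart (a, b, 0, Gamma_pi H gZ).
  by rewrite (@chart_pi _ _ _ _ g)// big_cell0.
rewrite /return_map {1}xE roof_chart// coset_actE; congr pi.
rewrite mulgA -[farey_mx (a, b)]big_cell0 horo_big_cell add0r.
rewrite (@big_cell_return R k) ?gt_eqF//= subrr big_cell0 -mulgA.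
by [].
Qed.

Lemma return_map_fun : set_fun (lifted_section H) (lifted_section H) return_map.
Proof. by move=> x /first_return_roof[[_ ?] _]. Qed.

End dynamics.

(** * Integrals of powers and sums of series *)

Section power_integral.
Variable R : realType.
Local Open Scope ereal_scope.

Lemma integral_power (c x : R) n : (0 < x)%R ->
  \int[lebesgue_measure]_(u in `[0%R, x]) (c * u ^+ n)%:E =
  (c * x ^+ n.+1 / n.+1%:R)%:E.
Proof.
move=> x0; pose F (u : R) : R := (c / n.+1%:R * u ^+ n.+1)%R.
have dF (u : R) : is_derive u 1%R F (c * u ^+ n)%R.
  have -> : F = ((c / n.+1%:R) *: (id ^+ n.+1 : R -> R))%R.
    by apply/funext => t; rewrite /F exprfctE.
  apply: (is_derive_eq (is_deriveZ _ (is_deriveX n.+1 (is_derive_id u 1%R)))).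
  by rewrite /GRing.scale/= mulr1 mulrA divfK// pnatr_eq0.
have cF : continuous F.
  by move=> u; apply: differentiable_continuous; apply/derivable1_diffP; exact: ex_derive.
rewrite (@continuous_FTC2 R (fun u => c * u ^+ n)%R F 0%R x)//.
- by rewrite -EFinB /F expr0n/= mulr0 subr0; congr EFin; ring.
- apply: continuous_subspaceT => u; apply: cvgM; first exact: cvg_cst.
  exact: exprn_continuous.
- split.
  + by move=> u _; exact: ex_derive.
  + exact: cvg_at_right_filter (cF _).
  + exact: cvg_at_left_filter (cF _).
- by move=> u _; rewrite derive1E; exact: derive_val.
Qed.

Lemma measurable_power (c : R) n (D : set R) :
  measurable_fun D (fun u : R => (c * u ^+ n)%:E).
Proof.
by apply/measurable_EFinP; apply: measurable_funTS; apply: measurable_funM.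
Qed.

Lemma integral_power_co (c x : R) n : (0 < x)%R -> (0 <= c)%R ->
  \int[@lebR R]_(u in `[0%R, x[) (c * u ^+ n)%:E = (c * x ^+ n.+1 / n.+1%:R)%:E.
Proof.
move=> x0 c0; rewrite ge0_integral_lebR//; last 2 first.
- exact: measurable_power.
- move=> u /=; rewrite in_itv/= => /andP[u0 _].
  by rewrite lee_fin mulr_ge0// exprn_ge0.
by rewrite integral_itv_bndo_bndc ?integral_power//; exact: measurable_power.
Qed.

Lemma integral_power_oc (c x : R) n : (0 < x)%R -> (0 <= c)%R ->
  \int[@lebR R]_(u in `]0%R, x]) (c * u ^+ n)%:E = (c * x ^+ n.+1 / n.+1%:R)%:E.
Proof.
move=> x0 c0; rewrite ge0_integral_lebR//; last 2 first.
- exact: measurable_power.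
- move=> u /=; rewrite in_itv/= => /andP[u0 _].
  by rewrite lee_fin mulr_ge0// exprn_ge0// ltW.
by rewrite integral_itv_obnd_cbnd ?integral_power//; exact: measurable_power.
Qed.

Lemma nneseries_EFin (f : R^nat) (l : R) : series f @ \oo --> l ->
  \sum_(n <oo) (f n)%:E = l%:E.
Proof.
move=> fl; apply: cvg_lim => //.
rewrite (_ : (fun n => _) = EFin \o series f).
  by apply: cvg_EFin => //; exact: nearW.
by apply/funext => n /=; rewrite /series/= sumEFin.
Qed.

Lemma nneseries_geometric (c u : R) : (0 <= u < 1)%R ->
  \sum_(n <oo) (c * u ^+ n)%:E = (c / (1 - u))%:E.
Proof.
move=> /andP[u0 u1]; apply: nneseries_EFin.
by apply: cvg_geometric_series; rewrite ger0_norm.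
Qed.

Lemma nneseries_zeta2 : \sum_(n <oo) (n.+1%:R ^- 2)%:E = (pi ^+ 2 / 6 : R)%:E.
Proof.
apply: nneseries_EFin; rewrite (_ : series _ = @zeta2_sum R); first exact: cvg_zeta2_sum.
by apply/funext => n; rewrite /series/= big_mkord.
Qed.

End power_integral.

(** * Volume of the fundamental domain *)

Section fund_mass.
Variable R : realType.
Local Open Scope ereal_scope.

(** The length of the fibre of [fund_main] over [(a, b)] when [0 < a <= 1]. *)
Let G (a b : R) : \bar R :=
  if (1 - a < b <= 1)%R then ((a * b)^-1)%:E else 0.

(** With b = 1 - u the integrand is 1/(a (1 - u)) on [0, a[, a geometric series integrated term by
    term. No logarithm appears, and [a = 1], where both sides are infinite, needs no separate
    treatment. *)
Lemma farey_inner (a : R) : (0 < a <= 1)%R ->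
  \int[@lebR R]_b G a b = \sum_(n <oo) (n.+1%:R^-1 * a ^+ n)%:E.
Proof.
move=> /andP[a0 a1].
have mG : measurable_fun setT (G a).
  apply: measurable_fun_ifT => //.
    apply: measurable_and; first exact: measurable_fun_ltr.
    exact: measurable_fun_ler.
  apply/measurable_EFinP; apply: (measurableT_comp (@measurable_invr R)).
  exact: measurable_funM.
have G0 b : 0 <= G a b.
  rewrite /G; case: ifP => // /andP[b0 _]; rewrite lee_fin invr_ge0 mulr_ge0 ?ltW//.
  by apply: le_lt_trans b0; rewrite subr_ge0.
have N1 : (-1 != 0 :> R)%R by rewrite oppr_eq0 oner_eq0.
have := ge0_integral_affine 1 N1 mG G0; rewrite normrN1 invr1 mul1e => <-.
transitivity (\int[@lebR R]_(u in `[0%R, a[) \sum_(n <oo) (a^-1 * u ^+ n)%:E).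
  rewrite [RHS]integral_mkcond; apply: eq_integral => u _.
  rewrite patchE mem_setE in_itv/= /G.
  have -> : (1 - a < -1 * u + 1 <= 1)%R = (0 <= u < a)%R.
    have -> : (-1 * u + 1 = 1 - u)%R by ring.
    by rewrite ltrD2l ltrN2 gerDl oppr_le0 andbC.
  case: ifP => // /andP[u0 ua].
  rewrite nneseries_geometric ?u0 ?(lt_le_trans ua)//.
  by congr EFin; rewrite invfM; congr (_ * _^-1)%R; ring.
rewrite integral_nneseries//; last 2 first.
- by move=> n; exact: measurable_power.
- move=> n u /=; rewrite in_itv/= => /andP[u0 _].
  by rewrite lee_fin mulr_ge0 ?invr_ge0 ?exprn_ge0// ltW.
apply: eq_eseriesr => n _; rewrite integral_power_co ?invr_ge0 ?(ltW a0)//.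
by congr EFin; rewrite exprS mulKf ?gt_eqF// mulrC.
Qed.

Lemma measurable_fund_main : measurable (@fund_main R).
Proof.
rewrite (_ : @fund_main R = @fund_dom R `&` [set q : R * R * R | (q.1.1 <= 1)%R]).
  apply: measurableI; first exact: measurable_fund_dom.
  rewrite -[X in measurable X]setTI.
  have := @measurable_coord1 R measurableT _ (@measurable_itv R `]-oo, 1%R]).
  by congr measurable; apply/seteqP; split => q /=; rewrite in_itv.
apply/seteqP; split => q; first by move=> Dq; split; [left|case: Dq => -[/andP[]]].
by move=> [[//|[a1 _ _]]] /=; rewrite leNgt a1.
Qed.

Lemma measurable_fund_cusp : measurable (@fund_cusp R).
Proof.
rewrite (_ : @fund_cusp R = @fund_dom R `&` [set q : R * R * R | (1 < q.1.1)%R]).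
  apply: measurableI; first exact: measurable_fund_dom.
  rewrite -[X in measurable X]setTI.
  have := @measurable_coord1 R measurableT _ (@measurable_itv R `]1%R, +oo[).
  by congr measurable; apply/seteqP; split => q /=; rewrite in_itv/= andbT.
apply/seteqP; split => q; first by move=> Dq; split; [right|case: Dq].
by move=> [[[[/= /andP[_ a1] _ _] _]|//]] /=; rewrite ltNge a1.
Qed.

Lemma leb3_fund_main : leb3 (@fund_main R) = (pi ^+ 2 / 6)%:E.
Proof.
have mM := measurable_fund_main.
rewrite (leb3E mM).
transitivity (\int[@lebR R]_(a in `]0%R, 1%R]) \sum_(n <oo) (n.+1%:R^-1 * a ^+ n)%:E).
  rewrite [RHS]integral_mkcond; apply: eq_integral => a _.
  rewrite patchE mem_setE in_itv/=; case: ifPn => a01; last first.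
    apply: integral0_eq => b _.
    rewrite (_ : [set s | _] = set0) ?measure0//.
    by apply/seteqP; split => // s [[]] /=; rewrite (negbTE a01).
  rewrite -farey_inner//; apply: eq_integral => b _; rewrite /G.
  have /andP[a0 a1] := a01.
  case: ifPn => [/andP[b0 b1]|nb]; last first.
    rewrite (_ : [set s | _] = set0) ?measure0//.
    apply/seteqP; split => // s [[/= _ /andP[_ b1] ab] _]; move/negP: nb; apply.
    by rewrite b1 ltrBlDl ab.
  have b00 : (0 < b)%R by apply: le_lt_trans b0; rewrite subr_ge0.
  rewrite (_ : [set s | _] = `[0%R, ((a * b)^-1)%R[%classic).
    rewrite lebRE lebesgue_measure_itv/= lte_fin invr_gt0 mulr_gt0//.
    by rewrite oppr0 adde0.
  apply/seteqP; split => s /=; rewrite in_itv/=; first by case.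
  move=> s0; split => //; split => /=; [exact: a01|by rewrite b00|by rewrite -ltrBlDl].
rewrite integral_nneseries//; last 2 first.
- by move=> n; exact: measurable_power.
- move=> n u /=; rewrite in_itv/= => /andP[u0 _].
  by rewrite lee_fin mulr_ge0 ?invr_ge0 ?exprn_ge0// ltW.
rewrite -nneseries_zeta2; apply: eq_eseriesr => n _.
rewrite integral_power_oc ?invr_ge0//; congr EFin.
by rewrite expr1n mulr1 expr2 invfM.
Qed.

Lemma leb3_fund_cusp (A : set (R * R * R)%type) : measurable A ->
  A `<=` @fund_cusp R -> leb3 A = 0.
Proof.
move=> mA Ac; apply/eqP; rewrite -measure_le0.
have mZ : measurable (([set: R] `*` [set 0%R : R]) `*` [set: R]).
  by apply: measurableX => //; exact: measurableX.
apply: (@le_trans _ _ (leb3 (([set: R] `*` [set 0%R : R]) `*` [set: R]))).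
  apply: le_measure; [exact: mem_set|exact: mem_set|].
  by move=> q /Ac[_ b0 _]; split => //; split.
have m0 : measurable ([set: R] `*` [set 0%R : R]) by exact: measurableX.
have -> : leb3 (([set: R] `*` [set 0%R : R]) `*` [set: R]) =
    leb2 ([set: R] `*` [set 0%R : R]) * lebR [set: R].
  exact: (product_measure1E (@leb2 R) (@lebR R) m0 measurableT).
have -> : leb2 ([set: R] `*` [set 0%R : R]) = lebR [set: R] * lebR [set 0%R : R].
  exact: (product_measure1E (@lebR R) (@lebR R) measurableT (measurable_set1 0%R)).
by rewrite [lebR [set 0%R]]lebesgue_measure_set1 mule0 mul0e.
Qed.

Lemma leb3_fund_dom : leb3 (@fund_dom R) = (pi ^+ 2 / 6)%:E.
Proof.
have mcusp := measurable_fund_cusp; have mM := measurable_fund_main.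
have -> : leb3 (@fund_dom R) = leb3 (@fund_main R) + leb3 (@fund_cusp R).
  apply: measureU => //; apply/seteqP; split => // q.
  by move=> [[[/= /andP[_ a1] _ _] _] [a1' _ _]]; move: a1'; rewrite ltNge a1.
by rewrite leb3_fund_main (leb3_fund_cusp mcusp)// adde0.
Qed.

End fund_mass.

Local Open Scope ereal_scope.

Lemma ge0_integral_mrestr d (T : measurableType d) (R : realType)
    (m : {measure set T -> \bar R}) (D : set T) (mD : measurable D) (f : T -> \bar R) :
  measurable_fun setT f -> (forall x, 0 <= f x) ->
  \int[mrestr m mD]_x f x = \int[m]_(x in D) f x.
Proof.
move=> mf f0.
rewrite (@ge0_negligible_integral _ _ _ _ setT (~` D))//; last 2 first.
- exact: measurableC.
- by rewrite -(measure0 m) -(setICl D).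
rewrite setTD setCK; apply: (@eq_measure_integral _ _ _ _ m) => A mA AD.
by rewrite [LHS]/(m _) (setIidl AD).
Qed.

Section eq_measurable_integral.
Import HBNNSimple.

(* Unlike in [eq_measure_integral], m1 and m2 need not be registered as measures
   on the measurable structure of T. *)
Lemma eq_measurable_integral d (T : measurableType d) (R : realType)
    (m1 m2 : set T -> \bar R) (D : set T) (f : T -> \bar R) :
  (forall A, measurable A -> m1 A = m2 A) ->
  \int[m1]_(x in D) f x = \int[m2]_(x in D) f x.
Proof.
move=> m12; have es (h : {nnsfun T >-> R}) : sintegral m1 h = sintegral m2 h.
  by apply: eq_fsbigr => r _; rewrite m12//; exact: measurable_funPTI.
by rewrite /integral; congr (ereal_sup _ - ereal_sup _); apply/seteqP;
  split => _ [h ? <-]; exists h.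
Qed.

End eq_measurable_integral.

Section counting_finite.
Variables (T : choiceType) (R : realType).
Hypothesis Tfin : finite_set [set: T].

Lemma finite_countingE (A : set T) :
  counting A = \sum_(v \in [set: T]) (\1_A v : R)%:E :> \bar R.
Proof.
have Afin : finite_set A by exact: sub_finite_set Tfin.
rewrite /counting asboolT//.
transitivity (\sum_(v \in A) (1 : \bar R)).
  rewrite fsbig_finite//= big_const_seq count_predT.
  elim: (size _) => [//|k ih]; by rewrite iterS -ih -EFinD mulrS.
rewrite fsbig_mkcond; apply: eq_fsbigr => v _.
by rewrite patchE indicE; case: (v \in A).
Qed.

End counting_finite.

(** * Disintegration *)

Section section_measure.
Variables (R : realType) (H : groupClosed (SL2 R)).
Hypothesis HZ : {subset H <= SL2Z}.
Hypothesis Hfin : finite_set (Gamma_cosets H).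
Local Notation farey := (@farey_triangle R).
Local Notation mfarey := (@measurable_farey_triangle R).

(** [farey_measure] rebuilt on [leb2], so as to be a measure on the product structure of [R * R]
    used for the coordinates. *)
Let fm : {measure set (R * R)%type -> \bar R} :=
  mscale (2%R%:nng : {nonneg R})%R (mrestr (@leb2 R) mfarey).

Let integral_fm (g : (R * R)%type -> \bar R) :
  measurable_fun setT g -> (forall x, 0 <= g x) ->
  \int[fm]_x g x = 2%:E * \int[@leb2 R]_(ab in farey) g ab.
Proof.
move=> mg g0; transitivity (2%:E * \int[mrestr (@leb2 R) mfarey]_x g x).
  by apply: (@ge0_integral_mscale _ _ _ (mrestr (@leb2 R) mfarey)).
have e := @ge0_integral_mrestr _ _ _ (@leb2 R) _ mfarey _ mg g0.
by rewrite e.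
Qed.

Lemma farey_measureE (S : set (R * R)%type) : measurable S -> farey_measure S = fm S.
Proof.
move=> mS; congr (_ * _); rewrite /mrestr/=.
have mSF : measurable (S `&` farey) by apply: measurableI => //; exact: mfarey.
rewrite /leb2 /product_measure1.
transitivity (\int[lebesgue_measure]_a lebR (xsection (S `&` farey) a)).
  by apply: eq_integral => a _; rewrite /= lebRE.
rewrite -ge0_integral_lebR//.
exact: measurable_fun_xsection.
Qed.

Lemma measurable_section_param v :
  measurable_fun setT (fun ab : (R * R)%type => section_param (ab, v) : coset_space H).
Proof.
pose D : set (R * R)%type := [set ab | ab.1 != 0%R].
have mD : measurable D.
  rewrite (_ : D = ~` ((fst : (R * R)%type -> R) @^-1` [set 0%R])); last first.
    by apply/seteqP; split => ab /= /eqP.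
  apply: measurableC; rewrite -[X in measurable X]setTI.
  by apply: measurable_fst => //; exact: measurable_set1.
have -> : [set: (R * R)%type] = D `|` ~` D by rewrite setUv.
apply/measurable_funU => //; first exact: measurableC.
split.
  rewrite (_ : (fun ab => _) = (fun q => chart (q, v)) \o (fun ab : (R * R)%type => (ab, 0%R))); last first.
    by apply/funext => ab; rewrite section_paramE.
  apply: (measurable_comp _ _ (measurable_chart v)).
  - exact: measurable_cell_dom.
  - by move=> _ [ab Dab <-].
  - by apply/measurable_funTS; exact: measurable_fun_pair.
apply: (@eq_measurable_fun _ _ _ _ _ (cst (coset_act 1%g (val v)))) => //.
move=> ab /set_mem/=/negP/negPn/eqP ab0; rewrite /section_param/=; congr coset_act.
rewrite /farey_mx ab0 invr0 /sl2 /insubd insubF//.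
by rewrite det_mx22 !mulr0 subr0 eq_sym oner_eq0.
Qed.

Lemma section_measureE (B : set (coset_space H)) : measurable B ->
  section_measure H B =
  \sum_(v \in [set: Gamma_quo H]) fm ((fun ab => section_param (ab, v)) @^-1` B).
Proof.
move=> mB; have vfin := finite_Gamma_quo Hfin.
have mBv v : measurable ((fun ab => section_param (ab, v)) @^-1` B).
  by rewrite -[X in measurable X]setTI; exact: (measurable_section_param v measurableT mB).
rewrite /section_measure /pushforward /product_measure1.
rewrite (eq_measurable_integral _ _ farey_measureE).
transitivity (\int[fm]_ab \sum_(v \in [set: Gamma_quo H])
    (\1_((fun ab => section_param (ab, v)) @^-1` B) ab : R)%:E).
  apply: eq_integral => ab _; rewrite [LHS](finite_countingE R vfin).
  apply: eq_fsbigr => v _; rewrite !indicE; congr (EFin (GRing.natmul _ (nat_of_bool _))).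
  by apply/idP/idP => /set_mem h; apply/mem_set; [exact/set_mem|exact/mem_set].
rewrite ge0_integral_fsum//; last first.
  by move=> v; exact/measurable_EFinP/measurable_indic.
by apply: eq_fsbigr => v _; rewrite integral_indic// setIT.
Qed.

(** The product with the counting measure is a finite sum of pushforwards, one for each coset, and
    each is integrated on its own sheet. *)
Lemma ge0_integral_section_measure (g : coset_space H -> \bar R) :
  measurable_fun setT g -> (forall x, 0 <= g x) ->
  \int[section_measure H]_x g x =
  \sum_(v \in [set: Gamma_quo H])
    2%:E * \int[@leb2 R]_(ab in farey) g (section_param (ab, v)).
Proof.
move=> mg g0; have vfin := finite_Gamma_quo Hfin.
pose s : seq (Gamma_quo H) := fset_set [set: Gamma_quo H].
pose m k := pushforward_measure fm (measurable_section_param (nth point s k)).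
rewrite (@eq_measurable_integral _ _ _ _ (msum m (size s))); last first.
  move=> B mB; rewrite section_measureE// fsbig_finite//= (big_nth point) big_mkord.
  by [].
rewrite ge0_integral_measure_sum// fsbig_finite//= (big_nth point) big_mkord.
apply: eq_bigr => k _.
rewrite (ge0_integral_pushforward (measurable_section_param (nth point s k)))//.
have mgk : measurable_fun setT (g \o (fun ab => section_param (ab, nth point s k))).
  by apply: measurableT_comp => //; exact: measurable_section_param.
rewrite preimage_setT; exact: (integral_fm mgk (fun ab => g0 _)).
Qed.

Local Notation piece A v :=
  (@fund_main R `&` [set q | A (chart (q, v) : coset_space H)]).

Lemma measurable_fund_piece (A : set (coset_space H)) v :
  measurable A -> measurable (piece A v).
Proof.
move=> mA; rewrite (_ : piece A v = @fund_main R `&` fund_slice A v).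
  by apply: measurableI; [exact: measurable_fund_main|exact: measurable_fund_slice].
by apply/seteqP; split => q [Dq]; [move=> Aq; split => //; split => //; left|case].
Qed.

Lemma leb3_fund_slice (A : set (coset_space H)) v : measurable A ->
  @leb3 R (fund_slice A v) = leb3 (piece A v).
Proof.
move=> mA; have mp := measurable_fund_piece v mA; have ms := measurable_fund_slice v mA.
have mC : measurable (fund_slice A v `\` piece A v) by exact: measurableD.
rewrite -(measureU0 mp mC); last first.
  by apply: leb3_fund_cusp => // q [[[Dq|//] Aq] nq]; case: nq.
by rewrite setDUK// => q [Dq Aq]; split => //; left.
Qed.

Let flow_set A : set (coset_space H * R) := suspension H `&` suspension_flow @^-1` A.

(** Everything is expressed through the measurable map [fund_sect]: a point of the section is one
    whose third coordinate is 0, and flowing for time [s] replaces this 0 by [s]. *)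
Lemma measurable_flow_set A : measurable A -> measurable (flow_set A).
Proof.
move=> mA.
rewrite (_ : flow_set A = \bigcup_(v in [set: Gamma_quo H])
  [set xs | (fund_sect xs.1).2 = v /\ (fund_sect xs.1).1.2 = 0%R /\
            piece A v ((fund_sect xs.1).1.1, xs.2)]).
  apply: fin_bigcup_measurable; first exact: finite_Gamma_quo.
  move=> v _.
  have mfs := measurable_fund_sect HZ Hfin.
  have m1 : measurable_fun setT (fun x : coset_space H => (fund_sect x).1).
    exact: measurableT_comp measurable_fst mfs.
  have m2 : measurable_fun setT (fun xs : coset_space H * R => (fund_sect xs.1).2).
    exact: measurable_comp_fst (measurableT_comp measurable_snd mfs).
  have m12 : measurable_fun setT (fun xs : coset_space H * R => (fund_sect xs.1).1.2).
    exact: measurable_comp_fst (measurableT_comp measurable_snd m1).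
  have mp := @measurable_fun_pair_snd _ _ _ _ R _ _ (measurableT_comp measurable_fst m1).
  apply: measurableI.
    by rewrite -[X in measurable X]setTI; apply: (m2 measurableT [set v]).
  apply: measurableI.
    by rewrite -[X in measurable X]setTI; apply: (m12 measurableT [set 0%R]).
  by have := mp measurableT _ (measurable_fund_piece v mA); rewrite setTI.
apply/seteqP; split => -[x s] /=.
  move=> [/suspension_chart-/(_ HZ)[ab [v [-> Oab Ds]]]].
  rewrite /mkset /preimage /mkset suspension_flow_chart => Ax; exists v => //=.
  by rewrite fund_sectK//=; left; exact: fund_main0.
move=> [v _ /= e]; have [_ /esym cx] := fund_sectP x.
move: (fund_sect x) cx e => [[ab t] w] /= -> [-> [-> [Ds Ax]]].
have [Oab s01] := Ds.
split; last by rewrite /preimage /mkset suspension_flow_chart.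
split => /=; last by rewrite roof_chart.
by apply/lifted_sectionP => //; exists ab => //; exists v.
Qed.

(** The slice of [flow_set A] above [section_param (ab, v)] is the slice above [ab] of the part of
    [A] on the sheet [v]; the 2 is that of [farey_measure]. *)
Lemma measure_flow_set A : measurable A ->
  (section_measure H \x lebesgue_measure)%E (flow_set A) =
  2%:E * \sum_(v \in [set: Gamma_quo H]) @leb3 R (fund_slice A v).
Proof.
move=> mA; have mS := measurable_flow_set mA; rewrite /product_measure1.
transitivity (\int[section_measure H]_x lebR (xsection (flow_set A) x)).
  by congr (integral _ _ _); apply/funext => x; rewrite [RHS]lebRE.
rewrite ge0_integral_section_measure//; last exact: measurable_fun_xsection.
rewrite ge0_mule_fsumr//; apply: eq_fsbigr => v _; congr (_ * _).
rewrite leb3_fund_slice// leb3_leb2 integral_mkcond; apply: eq_integral => ab _.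
rewrite patchE; case: ifPn => [/set_mem Oab|/negP Oab].
  congr lebR; apply/seteqP; split => s.
    move=> /set_mem[[_ /=]]; rewrite section_paramE roof_chart//= => s01.
    by rewrite /preimage /mkset suspension_flow_chart => Ax; split.
  move=> [[_ s01] Ax]; apply/mem_set; rewrite section_paramE.
  split; last by rewrite /preimage /mkset suspension_flow_chart.
  split => /=; last by rewrite roof_chart.
  by apply/lifted_sectionP => //; exists ab => //; exists v.
rewrite (_ : [set s | _] = set0) ?measure0//; apply/seteqP; split => // s [[Oab' _] _].
by apply: Oab; exact: mem_set.
Qed.

End section_measure.

Section sigma_finite_pack.
Context d (T : measurableType d) (R : realType).
Variables (mu : {measure set T -> \bar R}) (s : sigma_finite setT mu).

Let m : set T -> \bar R := mu.
HB.instance Definition _ := Measure.on m.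
HB.instance Definition _ := Measure_isSigmaFinite.Build _ _ _ m s.

Definition sigma_finite_pack : {sigma_finite_measure set T -> \bar R} := m.

End sigma_finite_pack.

(** * Finiteness and normalization of the invariant measure *)

Section haar_mass.
Variables (R : realType) (H : groupClosed (SL2 R)).
Hypothesis HZ : {subset H <= SL2Z}.
Hypothesis Hfin : finite_set (Gamma_cosets H).

Lemma Gamma_index_gt0 : (0 < Gamma_index H)%N.
Proof.
rewrite /Gamma_index cardfs_gt0; apply/fset0Pn.
exists (\pi_(coset_space H) 1%g).
by rewrite in_fset_set// Gamma_cosets1.
Qed.

Lemma card_Gamma_quo : #|` fset_set [set: Gamma_quo H]| = Gamma_index H.
Proof.
have -> : Gamma_index H = #|` fset_set (val @` [set: Gamma_quo H])|.
  congr (#|` fset_set _|); apply/seteqP; split => [x Gx|_ [v _ <-]].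
    by exists (exist (fun x => x \in Gamma_cosets H) x (mem_set Gx)).
  exact: set_mem (valP v).
rewrite fset_set_image; last exact: finite_Gamma_quo.
by rewrite card_imfset//; exact: val_inj.
Qed.

Lemma haar_sect_setT :
  haar_SL2 (@sect_set R H setT) = ((Gamma_index H)%:R * (pi ^+ 2 / 6))%:E.
Proof.
rewrite haar_sect_set// (eq_fsbigr (fun=> (pi ^+ 2 / 6)%:E)); last first.
  by move=> v _; rewrite /fund_slice setIT leb3_fund_dom.
have vfin := finite_Gamma_quo Hfin.
rewrite fsbig_finite//= -card_Gamma_quo big_const_seq count_predT.
elim: (size _) => [|k ih]; first by rewrite mul0r.
by rewrite iterS ih -EFinD -(natr1 k) mulrDl mul1r addrC.
Qed.

Variable mu : {measure set (coset_space H) -> \bar R}.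
Hypothesis mu_haar : haar mu.

Lemma haar_sigma_finite : sigma_finite setT mu.
Proof.
have [[muK _ _] _ _] := mu_haar.
exists (@fund_exhaustion R H); first by rewrite bigcup_fund_exhaustion.
by move=> n; split; [exact: measurable_fund_exhaustion|
                      exact/muK/compact_fund_exhaustion].
Qed.

Lemma haar_identity A : measurable A ->
  mu A * haar_SL2 (@sect_set R H setT) = haar_SL2 (sect_set A) * mu setT.
Proof.
have [_ mui _] := mu_haar.
exact: (@haar_section_identity R H HZ Hfin (sigma_finite_pack haar_sigma_finite)).
Qed.

Lemma haar_SL2_ge0 (A : set (SL2 R)) : 0 <= haar_SL2 A.
Proof. exact: measure_ge0. Qed.

(** Infinite mass would force nu to vanish on every set of finite mu-measure, so on each compact set
    of the exhaustion and on their union G/H, against [haar_sect_setT]. *)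
Lemma haar_finite : mu setT < +oo.
Proof.
rewrite ltey; apply/eqP => muT.
have [[muK _ _] _ _] := mu_haar.
have E0 n : haar_SL2 (sect_set (fund_exhaustion n : set (coset_space H))) = 0.
  apply/eqP; rewrite eq_le haar_SL2_ge0 andbT leNgt; apply/negP => E0.
  have := haar_identity (measurable_fund_exhaustion HZ Hfin n).
  rewrite muT gt0_muley// haar_sect_setT => e.
  have : mu (fund_exhaustion n) < +oo by exact/muK/compact_fund_exhaustion.
  rewrite -ge0_fin_numE// => /fineK mE; move: e; rewrite -mE -EFinM.
  by [].
have : haar_SL2 (@sect_set R H setT) = 0.
  pose F n := @cell_dom R `&` (@big_cell R) @^-1` sect_set (fund_exhaustion n : set (coset_space H)).
  have mF n : measurable (F n).
    apply: measurable_cell_preimage; apply: measurable_sect_set => //.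
    exact: measurable_fund_exhaustion.
  rewrite /haar_SL2 (_ : _ `&` _ = \bigcup_n F n).
    apply/(@negligibleP _ _ _ (@leb3 R) _ (bigcupT_measurable _ mF)).
    by apply: negligible_bigcup => n; apply/negligibleP => //; exact: E0.
  apply/seteqP; split => q.
    move=> [q0 [_ sq]].
    have : (\bigcup_n @fund_exhaustion R H n) (\pi_(coset_space H) (big_cell q)).
      by rewrite bigcup_fund_exhaustion.
    by move=> [n _ En]; exists n.
  by move=> [n _ [q0 [_ sq]]].
rewrite haar_sect_setT => -[/eqP]; rewrite mulf_eq0 pnatr_eq0 -leqn0 leqNgt Gamma_index_gt0/=.
by rewrite gt_eqF// divr_gt0// exprn_gt0// pi_gt0.
Qed.

Lemma haar_normalized : exists c : {nonneg R},
  mscale c mu setT = ((pi ^+ 2 / 3) * (Gamma_index H)%:R)%:E /\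
  forall A : set (coset_space H), measurable A -> mscale c mu A = 2%:E * haar_SL2 (sect_set A).
Proof.
have m0 : (0 < fine (mu setT))%R.
  have [_ _ mu0] := mu_haar; rewrite fine_gt0// haar_finite andbT lt_neqAle eq_sym.
  by rewrite mu0 measure_ge0.
have mf : (fine (mu setT))%:E = mu setT by rewrite fineK// ge0_fin_numE// haar_finite.
have n0 : (0 < (Gamma_index H)%:R :> R)%R by rewrite ltr0n Gamma_index_gt0.
have p0 : (0 < pi :> R)%R := pi_gt0 R.
move: (fine (mu setT)) (Gamma_index H)%:R (pi : R) m0 mf n0 p0 haar_sect_setT => m n p m0 mf n0 p0 e.
have c0 : (0 <= p ^+ 2 / 3 * n / m)%R.
  by rewrite divr_ge0 ?mulr_ge0 ?divr_ge0 ?exprn_ge0// ltW.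
exists (NngNum c0); split.
  rewrite /mscale/= -mf -EFinM mulfVK// gt_eqF//.
move=> B mB; have := haar_identity mB; rewrite e -mf /mscale/= => eB.
(* The last factor is nu(G/H), isolated so that the identity for [B] applies. *)
have -> : (p ^+ 2 / 3 * n / m = 2 * m^-1 * (n * (p ^+ 2 / 6)))%R by field; rewrite gt_eqF.
rewrite EFinM -muleA (muleC _ (mu B)) eB EFinM -!muleA; congr (_ * _).
by rewrite muleCA -EFinM mulVf ?gt_eqF// mule1.
Qed.

End haar_mass.

(** * Null sets and the Poincare section *)

Section poincare.
Variables (R : realType) (H : groupClosed (SL2 R)).
Hypothesis HZ : {subset H <= SL2Z}.
Hypothesis Hfin : finite_set (Gamma_cosets H).
Variable mu : {measure set (coset_space H) -> \bar R}.
Hypothesis mu_haar : haar mu.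

(** Such a set is nu-null; as nu(G/H) is not 0, the identity transfers this to mu. *)
Lemma haar_null A : measurable A ->
  (forall v, fund_slice A v `<=` @fund_cusp R) -> mu A = 0.
Proof.
move=> mA Acusp; have := haar_identity HZ Hfin mu_haar mA.
rewrite haar_sect_setT// haar_sect_set// fsbig1 ?mul0e; last first.
  by move=> v _; exact: leb3_fund_cusp (measurable_fund_slice v mA) (Acusp v).
move=> /eqP; rewrite mule_eq0 => /orP[/eqP//|].
rewrite eqe mulf_eq0 pnatr_eq0 -leqn0 leqNgt Gamma_index_gt0//=.
by rewrite gt_eqF// divr_gt0// exprn_gt0// pi_gt0.
Qed.

Lemma negligible_flow_image :
  mu.-negligible (~` (suspension_flow @` suspension H)).
Proof.
rewrite suspension_image//; set D := ~` _.
have mD : measurable D.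
  apply: measurableC; rewrite -[X in measurable X]setTI.
  apply: (measurableT_comp measurable_fst (measurable_fund_sect HZ Hfin)) => //.
  exact: measurable_fund_main.
exists D; split => //; apply: haar_null => // v q [Dq].
by rewrite /D /setC /mkset fund_sectK//= => nq; case: Dq.
Qed.

Lemma poincare_lifted_section : poincare_section mu (lifted_section H).
Proof.
apply: negligibleS negligible_flow_image => x nx Sx; apply: nx; split.
- exact: hit_times_suspension.
- exact: countable_hit_times.
- exact: isolated_hit_times.
Qed.

End poincare.

Local Close Scope ereal_scope.
Unset Implicit Arguments.

Theorem theorem3 (R : realType) (H : groupClosed (SL2 R))
    (HGamma : {subset H <= SL2Z}) (Hfin : finite_set (Gamma_cosets H)) :
  let Omega2 := lifted_section H in
  let tau := roof \o @coset_proj R H in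
  [/\ (* Omega'' = P Gamma H / H *)
      Omega2 = [set \pi_(coset_space H) (p * g)%g | p in farey_mxs
                                                  & g in [set g | g \in SL2Z]],
      (* first return time and first return map *)
      is_return_time Omega2 tau /\
      (exists r' : coset_space H -> coset_space H,
        [/\ is_return_map Omega2 r', set_fun Omega2 Omega2 r' &
          forall a b gamma, farey_triangle (a, b) -> gamma \in SL2Z ->
          let x := \pi_(coset_space H) (farey_mx (a, b) * gamma)%g in
          let k := (Num.floor ((1 + a) / b))%:~R in
          r' x = coset_act (horo (tau x)) x /\
          r' x = \pi_(coset_space H)
                   (sl2 b (k * b - a) 0 b^-1 * (sl2 k 1 (- 1) 0 * gamma))%g]),
      (* the two identifications *)
      set_bij (farey_triangle `*` [set: Gamma_quo H]) Omega2
              section_param,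
      set_inj (suspension H) suspension_flow &
      (* Poincare section, and disintegration of the normalized Haar measure *)
      forall mu : {measure set (coset_space H) -> \bar R}, haar mu ->
        [/\ poincare_section mu Omega2,
            mu.-negligible (~` (suspension_flow @` suspension H)) &
            exists c : {nonneg R},
              mscale c mu [set: coset_space H] =
                (pi ^+ 2 / 3 * (Gamma_index H)%:R)%:E /\
              forall A : set (coset_space H), measurable A ->
                mscale c mu A =
                (section_measure H \x lebesgue_measure)%E
                  (suspension H `&` suspension_flow @^-1` A)]].
Proof.
move=> Omega2 tau; split.
- exact: lifted_sectionE.
- split; first by move=> x; exact: first_return_roof.
  exists (@return_map R H); split.
  + by move=> x Sx; exists (tau x) => //; exact: first_return_roof.
  + exact: return_map_fun.
  + by move=> a b g Oab gZ; split => //; exact: return_map_farey.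
- exact: section_param_bij.
- exact: suspension_flow_inj.
- move=> mu mu_haar; split.
  + exact: poincare_lifted_section.
  + exact: negligible_flow_image.
  + have [c [cT cA]] := haar_normalized HGamma Hfin mu_haar.
    exists c; split => // A mA.
    by rewrite cA// haar_sect_set// -measure_flow_set.
Qed.
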